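(* Let $d>3$ be a square-free integer and let $K=\mathbb Q(\sqrt{-d})$. Suppose that the prime $2$ is inert in $K/\mathbb Q$ (i.e. $d\equiv 3\pmod 8$) and that the class number of $K$ is prime to $6$. Then the only elliptic curves defined over $K$ having a $K$-rational point of order $2$ and conductor supported at the prime ideal $(2)$ are those that are base change of $\mathbb Q$; that is, every such elliptic curve is isomorphic over $K$ to the base change to $K$ of an elliptic curve defined over $\mathbb Q$.
   Context: ''Conductor supported at the prime ideal $(2)$'' means that no prime ideal of $K$ other than $(2)$ divides the conductor. *)

(* Defs.v *)
From HB Require Import structures.
From mathcomp Require Import all_boot all_order all_algebra all_fingroup all_field.
From mathcomp Require Import boolp classical_sets.

Set Implicit Arguments.
Unset Strict Implicit.
Unset Printing Implicit Defensive.

Import GRing.Theory.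
Local Open Scope ring_scope.

Definition squarefree (n : nat) : Prop :=
  forall m : nat, (m ^ 2 %| n)%N -> m = 1%N.

(** ** Ideals of the ring of integers of a number field *)

Section Ideals.
Variable F : fieldType.
Implicit Types (I J N p : set F) (x : F).

(* Used for fields F that are finite over rat: the integral closure of Z. *)
Definition ring_of_integers : set F :=
  [set x | integralOver (intr : int -> F) x]%classic.

(* An ideal is given by its underlying subset of F. *)
Definition is_ideal I : Prop :=
  [/\ (I `<=` ring_of_integers)%classic, I 0,
      forall x y, I x -> I y -> I (x + y)
    & forall a x, ring_of_integers a -> I x -> I (a * x)].

Definition nonzero_ideal I : Prop :=
  is_ideal I /\ exists2 x, I x & x != 0.

(* The zero ideal is excluded, as usual for the primes of a number field. *)
Definition prime_ideal p : Prop :=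
  [/\ nonzero_ideal p, ~ p 1
    & forall a b, ring_of_integers a -> ring_of_integers b ->
        p (a * b) -> p a \/ p b].

Definition principal_ideal (a : F) : set F :=
  [set x | exists2 y, ring_of_integers y & x = a * y]%classic.

Definition ideal_mul I J : set F :=
  [set x | exists2 s : seq (F * F),
     (forall ab, ab \in s -> I ab.1 /\ J ab.2)
     & x = \sum_(ab <- s) ab.1 * ab.2]%classic.

Fixpoint ideal_exp I (n : nat) : set F :=
  if n is n'.+1 then ideal_mul I (ideal_exp I n') else ring_of_integers.

Definition ideal_dvd I N : Prop :=
  exists2 J, is_ideal J & N = ideal_mul I J.

Definition ideal_equiv I J : Prop :=
  exists a b : F,
    [/\ ring_of_integers a, ring_of_integers b, a != 0, b != 0
      & ideal_mul (principal_ideal a) I = ideal_mul (principal_ideal b) J].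

(* h is the class number: some family indexed by 'I_h represents every
   ideal class exactly once. *)
Definition is_class_number (h : nat) : Prop :=
  exists2 c : 'I_h -> set F,
    forall i, nonzero_ideal (c i)
    & forall I, nonzero_ideal I -> exists! i, ideal_equiv I (c i).

(* For a rational prime q, q is inert when q generates a prime ideal. *)
Definition inert (q : nat) : Prop := prime_ideal (principal_ideal q%:R).

(** The local ring at a prime p, as a subset of F, and its units *)

Definition integral_at p : set F :=
  [set x | exists a b, [/\ ring_of_integers a, ring_of_integers b, ~ p b
                         & x = a / b]]%classic.

Definition unit_at p : set F :=
  [set x | exists a b, [/\ ring_of_integers a /\ ~ p a,
                           ring_of_integers b /\ ~ p b & x = a / b]]%classic.

End Ideals.

(** ** Weierstrass equations *)

(* y^2 + a1 x y + a3 y = x^3 + a2 x^2 + a4 x + a6 *)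
Record weierstrass (F : Type) := Weierstrass {
  wa1 : F; wa2 : F; wa3 : F; wa4 : F; wa6 : F }.

Definition base_change (F F' : Type) (f : F -> F') (W : weierstrass F) :=
  Weierstrass (f (wa1 W)) (f (wa2 W)) (f (wa3 W)) (f (wa4 W)) (f (wa6 W)).

Section Weierstrass.
Variable F : fieldType.
Implicit Types W : weierstrass F.

Definition wb2 W : F := wa1 W ^+ 2 + 4 * wa2 W.
Definition wb4 W : F := 2 * wa4 W + wa1 W * wa3 W.
Definition wb6 W : F := wa3 W ^+ 2 + 4 * wa6 W.
Definition wb8 W : F :=
  wa1 W ^+ 2 * wa6 W + 4 * wa2 W * wa6 W - wa1 W * wa3 W * wa4 W
  + wa2 W * wa3 W ^+ 2 - wa4 W ^+ 2.
Definition wc4 W : F := wb2 W ^+ 2 - 24 * wb4 W.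
Definition wdisc W : F :=
  - wb2 W ^+ 2 * wb8 W - 8 * wb4 W ^+ 3 - 27 * wb6 W ^+ 2
  + 9 * wb2 W * wb4 W * wb6 W.

Definition elliptic_curve W : Prop := wdisc W != 0.

(* The change of variables x = u^2 x' + r, y = u^3 y' + s u^2 x' + t
   carries the equation W to W'. *)
Definition isomorphic W W' : Prop :=
  exists u r s t : F, u != 0 /\
    [/\ u * wa1 W' = wa1 W + 2 * s,
        u ^+ 2 * wa2 W' = wa2 W - s * wa1 W + 3 * r - s ^+ 2,
        u ^+ 3 * wa3 W' = wa3 W + r * wa1 W + 2 * t,
        u ^+ 4 * wa4 W' = wa4 W - s * wa3 W + 2 * r * wa2 W
                          - (t + r * s) * wa1 W + 3 * r ^+ 2 - 2 * s * t
      & u ^+ 6 * wa6 W' = wa6 W + r * wa4 W + r ^+ 2 * wa2 W + r ^+ 3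
                          - t * wa3 W - t ^+ 2 - r * t * wa1 W].

(* Points with coordinates in F; None is the point at infinity O. *)
Definition rat_point : Type := option (F * F).

Definition on_curve W (P : rat_point) : bool :=
  if P is Some (x, y) then
    y ^+ 2 + wa1 W * x * y + wa3 W * y
      == x ^+ 3 + wa2 W * x ^+ 2 + wa4 W * x + wa6 W
  else true.

(* The chord-tangent law. *)
Definition point_add W (P Q : rat_point) : rat_point :=
  match P, Q with
  | None, _ => Q
  | _, None => P
  | Some (x1, y1), Some (x2, y2) =>
    if (x1 == x2) && (y2 == - y1 - wa1 W * x1 - wa3 W) then None
    else
      let m := if x1 == x2 then
                 (3 * x1 ^+ 2 + 2 * wa2 W * x1 + wa4 W - wa1 W * y1)
                   / (2 * y1 + wa1 W * x1 + wa3 W)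
               else (y2 - y1) / (x2 - x1) in
      let x3 := m ^+ 2 + wa1 W * m - wa2 W - x1 - x2 in
      Some (x3, - (y1 + m * (x3 - x1)) - wa1 W * x3 - wa3 W)
  end.

Definition point_mul W (n : nat) (P : rat_point) : rat_point :=
  iter n (point_add W P) None.

Definition has_order W (P : rat_point) (n : nat) : Prop :=
  [/\ on_curve W P, (0 < n)%N, point_mul W n P = None
    & forall m, (0 < m < n)%N -> point_mul W m P <> None].

(** Reduction at a prime p of F *)

Definition integral_model p W : Prop :=
  [/\ integral_at p (wa1 W), integral_at p (wa2 W), integral_at p (wa3 W),
      integral_at p (wa4 W) & integral_at p (wa6 W)].

(* Minimality of v_p(wdisc M) among the integral models is expressed by
   integrality of the quotients of discriminants. *)
Definition minimal_model p W M : Prop :=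
  [/\ isomorphic W M, integral_model p M
    & forall M', isomorphic W M' -> integral_model p M' ->
        integral_at p (wdisc M' / wdisc M)].

(* Tame part of the conductor exponent, for M minimal at p: 0, 1, 2 for good,
   multiplicative and additive reduction.  A singular reduction has a node when
   c4 is a unit at p and a cusp otherwise. *)
Definition tame_exponent p M : nat :=
  if `[< unit_at p (wdisc M) >] then 0
  else if `[< unit_at p (wc4 M) >] then 1 else 2.

End Weierstrass.

(** ** The conductor *)

Section Ramification.
Variables (K : fieldType) (L : splittingFieldType K).

Definition lies_over (P : set L) (p : set K) : Prop :=
  forall x : K, p x <-> ring_of_integers x /\ P x%:A.

(* The i-th ramification group, in the lower numbering, of a prime P of L; the
   case i = 0 is the inertia group. *)
Definition ramification_group (P : set L) (i : nat)
    : {set gal_of {:L}%AS} :=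
  [set g in 'Gal({:L} / 1)%g |
    `[< forall x, ring_of_integers x -> ideal_exp P i.+1 (g x - x) >]].

Definition gal_point (g : gal_of {:L}%AS) (Q : rat_point L) : rat_point L :=
  omap (fun xy => (g xy.1, g xy.2)) Q.

Definition coordinates (T : seq (rat_point L)) : seq L :=
  flatten [seq [:: xy.1; xy.2] | xy <- pmap id T].

(* T lists the l^2 points of order dividing l, all of them rational over L. *)
Definition full_torsion (W : weierstrass L) (l : nat) (T : seq (rat_point L))
    : Prop :=
  [/\ uniq T, size T = (l ^ 2)%N
    & forall Q, (Q \in T) = on_curve W Q && (point_mul W l Q == None)].

Definition fixed_dim (l : nat) (T : seq (rat_point L)) (G : {set gal_of {:L}%AS})
    : nat :=
  logn l (count (fun Q => [forall g in G, gal_point g Q == Q]) T).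

End Ramification.

(* Wild part of the conductor exponent:
     delta = sum_(i >= 1) #|G_i| / #|G_0| * dim (E[l] / E[l]^(G_i)),
   where l is a prime distinct from the residue characteristic of p,
   L = K(E[l]), and the G_i are the ramification groups of a prime of L above
   p.  The sum stops where the decreasing sequence G_i becomes trivial.  The
   value does not depend on l nor on the prime above p. *)
Definition wild_exponent (K : fieldType) (E : weierstrass K) (p : set K)
    (delta : rat) : Prop :=
  exists (l : nat) (L : splittingFieldType K) (T : seq (rat_point L))
         (P : set L) (n : nat),
    let G := ramification_group P in
    [/\ prime l /\ ~ p l%:R,
        full_torsion (base_change (in_alg L) E) l T,
        <<1 & coordinates T>>%VS = fullv,
        prime_ideal P /\ lies_over P p
      & G n \subset [1]%g /\
        delta = \sum_(1 <= i < n)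
                  #|G i|%:R / #|G 0%N|%:R * (2 - (fixed_dim l T (G i))%:R)].

Definition conductor_exponent (K : fieldType) (E : weierstrass K)
    (p : set K) (f : nat) : Prop :=
  exists (M : weierstrass K) (delta : rat),
    [/\ minimal_model p E M, wild_exponent E p delta
      & f%:R = (tame_exponent p M)%:R + delta].

(* N is the product of the p^f(p), f(p) being the conductor exponent at p. *)
Definition is_conductor (K : fieldType) (E : weierstrass K) (N : set K)
    : Prop :=
  nonzero_ideal N /\
  forall p, prime_ideal p -> exists f,
    [/\ conductor_exponent E p f, ideal_dvd (ideal_exp p f) N
      & ~ ideal_dvd (ideal_exp p f.+1) N].

(* Main.v *)
Require Import Defs.
From HB Require Import structures.
From mathcomp Require Import all_boot all_order all_algebra all_fingroup all_field.
From mathcomp Require Import boolp classical_sets.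
From mathcomp Require Import ring zify.

Set Implicit Arguments.
Unset Strict Implicit.
Unset Printing Implicit Defensive.

Import Order.TTheory GRing.Theory Num.Theory.
Local Open Scope ring_scope.

(** A curve with a rational 2-torsion point has an equation
    y^2 = x^3 + a x^2 + b x, of discriminant 16 b^2 (a^2 - 4 b).  The exponent of
    the conductor at a prime is a sum of two nonnegative parts, so at every prime
    P other than (2) both vanish and some model has unit discriminant
    ([good_reduction]).  As 2 is a unit at P, the 2-torsion point is integral on
    that model, and comparing the two equations gives u such that b / u^4 and
    (a^2 - 4 b) / u^4 are units at P ([torsion2_form_good]).

    Hence (b) = (2)^k J^4 for some ideal J, up to replacing b by its product
    with the fourth power of an integer ([descent]).  So the class of J^4 is
    trivial, and since the class number is odd J itself is principal
    ([sqr_class_odd]).  The only units are 1 and -1 ([ringint_unit]), so after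
    rescaling the equation b is +-2^k.  Then a^2 - 4 b is a unit at all primes
    other than (2), and it is +-2^m with m an integer ([unit_away_frac]).

    Consequently a^2 is rational, and a is either rational, in which case the
    equation has rational coefficients, or a rational multiple of sqrt(-d).  The
    latter would give d c^2 = +-2^m +- 2^n with c a nonzero integer; as d = 3
    modulo 8 when 2 is inert ([inert_mod8]), comparing odd parts modulo 8 leaves
    only d c^2 = 3 for some odd c, impossible for d > 3 ([sqr_ne_two_powers]).

    The ideal theory of K rests on one fact: for a nonzero ideal I with conjugate
    I', the product I I' is generated by a positive integer ([idl_mul_conj]).
    This makes ideals invertible, so that to contain is to divide, and these
    integers decrease along strictly ascending chains of ideals.  The record
    [dedekind] collects these consequences, and factorization into primes is
    derived from it alone. *)

(** * The semiring of ideals *)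

Section RingOfIntegers.
Variable F : fieldType.
Local Notation O := (@ring_of_integers F).

Lemma ringint_nat n : O n%:R.
Proof. exact: integral_nat. Qed.

Lemma ringint_int n : O n%:~R.
Proof. exact: integral_id. Qed.

Lemma ringint0 : O 0. Proof. exact: (ringint_nat 0). Qed.
Lemma ringint1 : O 1. Proof. exact: (ringint_nat 1). Qed.

Lemma ringintD x y : O x -> O y -> O (x + y).
Proof. exact: integral_add. Qed.

Lemma ringintN x : O x -> O (- x).
Proof. exact: integral_opp. Qed.

Lemma ringintB x y : O x -> O y -> O (x - y).
Proof. exact: integral_sub. Qed.

Lemma ringintM x y : O x -> O y -> O (x * y).
Proof. exact: integral_mul. Qed.

Lemma ringintX x n : O x -> O (x ^+ n).
Proof.
by move=> Ox; elim: n => [|n IHn]; [exact: ringint1 | rewrite exprS; exact: ringintM].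
Qed.

End RingOfIntegers.

#[local] Hint Resolve ringint0 ringint1 ringint_nat : core.

(** The tail of a monic polynomial is given as a list; integrality over O is
    integrality over the integers by transitivity. *)
Lemma ringint_monic_root (F : fieldType) (s : seq F) x :
  (forall c, c \in s -> ring_of_integers c) ->
  (Poly (rcons s 1)).[x] = 0 -> ring_of_integers x.
Proof.
move=> Os root_x; have Es : Poly (rcons s 1) = rcons s 1 :> seq F.
  by rewrite (PolyK (c := 0)) ?last_rcons ?oner_eq0.
apply: (@integral_root_monic _ _ _ x (Poly (rcons s 1))).
- by rewrite monicE lead_coefE Es size_rcons nth_rcons ltnn eqxx.
- exact/rootP.
- by rewrite Es => c; rewrite mem_rcons inE => /predU1P[->|/Os //]; exact: ringint1.
Qed.

(** Ideals are bundled so that they form a commutative semiring, whose unit is O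
    and whose zero is the zero ideal; products and powers of ideals then follow
    the usual algebraic rules. *)
Record idl (F : fieldType) := Idl { idl_set :> F -> Prop; idlP : is_ideal idl_set }.

HB.instance Definition _ F := gen_eqMixin (idl F).
HB.instance Definition _ F := gen_choiceMixin (idl F).

Section IdealSemiring.
Variable F : fieldType.
Local Notation O := (@ring_of_integers F).
Implicit Types I J L : idl F.

Lemma idl_eq I J : (forall x, I x <-> J x) -> I = J.
Proof.
case: I J => [I iI] [J iJ] /= eqIJ.
have {}eqIJ : I = J by apply/funext => x; apply/propext.
by case: _ / eqIJ in iJ *; congr Idl; apply: Prop_irrelevance.
Qed.

Lemma idl_sub I x : I x -> O x.
Proof. by case: (idlP I) => sub *; apply: sub. Qed.
Lemma idl0 I : I 0.
Proof. by case: (idlP I). Qed.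
Lemma idlD I x y : I x -> I y -> I (x + y).
Proof. by case: (idlP I) => _ _ cl _; apply: cl. Qed.
Lemma idlM I a x : O a -> I x -> I (a * x).
Proof. by case: (idlP I) => _ _ _; apply. Qed.
Lemma idlMr I a x : O a -> I x -> I (x * a).
Proof. by rewrite mulrC; apply: idlM. Qed.
Lemma idlN I x : I x -> I (- x).
Proof. by move=> Ix; rewrite -mulN1r; apply: idlM => //; apply: ringintN. Qed.
Lemma idlB I x y : I x -> I y -> I (x - y).
Proof. by move=> Ix Iy; apply/idlD/idlN. Qed.
Lemma idl_sum I (T : eqType) (s : seq T) (f : T -> F) :
  (forall t, t \in s -> I (f t)) -> I (\sum_(t <- s) f t).
Proof.
by move=> If; rewrite big_seq; apply: big_ind => //; [exact: idl0|exact: idlD].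
Qed.

Lemma ideal_mul_sub (A B : set F) I :
  (forall a b, A a -> B b -> I (a * b)) -> forall x, ideal_mul A B x -> I x.
Proof.
move=> sub x [s ABs ->]; apply: idl_sum => t /ABs[At Bt]; exact: sub.
Qed.

Lemma mem_ideal_mul (A B : set F) a b : A a -> B b -> ideal_mul A B (a * b).
Proof.
move=> Aa Bb; exists [:: (a, b)]; last by rewrite big_seq1.
by move=> t; rewrite inE => /eqP->.
Qed.

Lemma is_ideal_mul I J : is_ideal (ideal_mul I J).
Proof.
split.
- move=> x [s IJs ->]; rewrite big_seq.
  apply: big_ind => [||ab /IJs[]]; [exact: ringint0|exact: ringintD|].
  by move=> Ia Jb; apply: ringintM; apply: idl_sub; eassumption.
- by exists [::]; rewrite ?big_nil.
- move=> _ _ [s IJs ->] [t IJt ->]; exists (s ++ t); last by rewrite big_cat.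
  by move=> ab; rewrite mem_cat => /orP[/IJs|/IJt].
- move=> a _ Oa [s IJs ->]; exists [seq (a * x.1, x.2) | x <- s].
    by move=> _ /mapP[x /IJs[Ix Jx] ->]; split => //; apply: idlM.
  by rewrite big_map mulr_sumr; apply: eq_bigr => x _; rewrite mulrA.
Qed.

Definition mul_idl I J := Idl (is_ideal_mul I J).

Lemma is_ideal_zero : is_ideal [set 0 : F]%classic.
Proof.
split=> [_ ->||_ _ -> ->|a _ _ ->]; rewrite ?addr0 ?mulr0 //; exact: ringint0.
Qed.

Lemma is_ideal_one : is_ideal O.
Proof. by split=> //; [exact: ringintD|exact: ringintM]. Qed.

Lemma is_ideal_add I J :
  is_ideal [set x | exists a b, [/\ I a, J b & x = a + b]]%classic.
Proof.
split=> /=.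
- by move=> _ [a [b [Ia Jb ->]]]; apply: ringintD; apply: idl_sub; eassumption.
- by exists 0, 0; split; rewrite ?addr0 //; apply: idl0.
- move=> _ _ [a [b [Ia Jb ->]]] [a' [b' [Ia' Jb' ->]]].
  by exists (a + a'), (b + b'); split; [exact: idlD|exact: idlD|rewrite addrACA].
- move=> c _ Oc [a [b [Ia Jb ->]]]; exists (c * a), (c * b).
  by split; rewrite ?mulrDr //; apply: idlM.
Qed.

Definition add_idl I J := Idl (is_ideal_add I J).

Lemma mem_add_idl I J a b : I a -> J b -> add_idl I J (a + b).
Proof. by move=> Ia Jb; exists a, b. Qed.

Lemma mem_add_idll I J a : I a -> add_idl I J a.
Proof. by move=> Ia; rewrite -[a]addr0; apply: mem_add_idl => //; apply: idl0. Qed.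

Lemma mem_add_idlr I J a : J a -> add_idl I J a.
Proof. by move=> Ia; rewrite -[a]add0r; apply: mem_add_idl => //; apply: idl0. Qed.

Lemma add_idl_sub I J L : (forall x, I x -> L x) -> (forall x, J x -> L x) ->
  forall x, add_idl I J x -> L x.
Proof. by move=> IL JL _ [a [b [/IL La /JL Lb ->]]]; apply: idlD. Qed.

Fact add_idlA : associative add_idl.
Proof.
move=> I J L; apply: idl_eq => x; split; apply: add_idl_sub => {}x.
- by move=> Ix; do 2!apply: mem_add_idll.
- apply: add_idl_sub => {}x H; last exact: mem_add_idlr.
  by apply: mem_add_idll; apply: mem_add_idlr.
- apply: add_idl_sub => {}x H; first exact: mem_add_idll.
  by apply: mem_add_idlr; apply: mem_add_idll.
- by move=> Ix; do 2!apply: mem_add_idlr.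
Qed.

Fact add_idlC : commutative add_idl.
Proof.
by move=> I J; apply: idl_eq => x; split; apply: add_idl_sub => {}x H;
  (exact: mem_add_idll || exact: mem_add_idlr).
Qed.

Fact add_idl0 : left_id (Idl is_ideal_zero) add_idl.
Proof.
move=> I; apply: idl_eq => x; split; last exact: mem_add_idlr.
by apply: add_idl_sub => // _ ->; apply: idl0.
Qed.

HB.instance Definition _ := GRing.isNmodule.Build (idl F) add_idlA add_idlC add_idl0.

Fact mul_idlC : commutative mul_idl.
Proof.
by move=> I J; apply: idl_eq => x; split; apply: ideal_mul_sub => a b Ia Jb;
  rewrite mulrC; apply: mem_ideal_mul.
Qed.

Fact mul_idlA : associative mul_idl.
Proof.
have sub I J L x : mul_idl I (mul_idl J L) x -> mul_idl (mul_idl I J) L x.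
  case=> s ILs ->; apply: idl_sum => -[a y] /ILs[/= Ia [t JLt ->]].
  rewrite /fst /snd mulr_sumr.
  apply: (@idl_sum (mul_idl (mul_idl I J) L)) => -[b c] /JLt[/= Jb Lc].
  by rewrite mulrA; do 2![apply: mem_ideal_mul => //].
move=> I J L; apply: idl_eq => x; split; first exact: sub.
by rewrite mul_idlC [mul_idl I J]mul_idlC => /sub; rewrite [mul_idl L _]mul_idlC mul_idlC.
Qed.

Fact mul_idl1 : left_id (Idl is_ideal_one) mul_idl.
Proof.
move=> I; apply: idl_eq => x; split; first by apply: ideal_mul_sub => a b; apply: idlM.
by move=> Ix; rewrite -[x]mul1r; apply: mem_ideal_mul => //; apply: ringint1.
Qed.

Fact mul_idlDl : left_distributive mul_idl add_idl.
Proof.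
move=> I J L; apply: idl_eq => x; split.
  apply: ideal_mul_sub => _ c [a [b [Ia Jb ->]]] Lc.
  by rewrite mulrDl; apply: mem_add_idl; apply: mem_ideal_mul.
apply: add_idl_sub => {}x; apply: ideal_mul_sub => a b Ha Hb;
  apply: mem_ideal_mul => //; [exact: mem_add_idll|exact: mem_add_idlr].
Qed.

Fact mul_idl0 : left_zero (Idl is_ideal_zero) mul_idl.
Proof.
move=> I; apply: idl_eq => x; split; last by move=> ->; apply: idl0.
by apply: ideal_mul_sub => a b ->; rewrite mul0r.
Qed.

HB.instance Definition _ := GRing.Nmodule_isComPzSemiRing.Build (idl F)
  mul_idlA mul_idlC mul_idl1 mul_idlDl mul_idl0.

Lemma idl_setM I J : (I * J : idl F) = ideal_mul I J :> (F -> Prop). Proof. by []. Qed.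
Lemma idl_setX I n : (I ^+ n : idl F) = ideal_exp I n :> (F -> Prop).
Proof. by elim: n => // n IHn; rewrite exprS idl_setM IHn. Qed.

Lemma idl_eq1 I : I 1 -> I = 1.
Proof.
move=> I1; apply: idl_eq => x; split; first exact: idl_sub.
by move=> Ox; rewrite -[x]mulr1; apply: idlM.
Qed.

Lemma idl_mull I J x : (I * J)%R x -> I x.
Proof. by apply: ideal_mul_sub => a b Ia /idl_sub; rewrite mulrC => Ob; apply: idlM. Qed.
Lemma idl_mulr I J x : (I * J)%R x -> J x.
Proof. by rewrite mulrC; apply: idl_mull. Qed.

Lemma is_ideal_principal (a : F) : O a -> is_ideal (principal_ideal a).
Proof.
move=> Oa; split.
- by move=> _ [y Oy ->]; apply: ringintM.
- by exists 0; rewrite ?mulr0 //; apply: ringint0.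
- by move=> _ _ [y Oy ->] [z Oz ->]; exists (y + z); rewrite ?mulrDr //; apply: ringintD.
- by move=> b _ Ob [y Oy ->]; exists (b * y); rewrite 1?mulrCA //; apply: ringintM.
Qed.

(** The value for a outside O is arbitrary: it makes [pidl] a total function. *)
Definition pidl (a : F) : idl F :=
  if pselect (O a) is left Oa then Idl (is_ideal_principal Oa) else 0.

Lemma pidlE a : O a -> pidl a = principal_ideal a :> (F -> Prop).
Proof. by move=> Oa; rewrite /pidl; case: pselect => [p|/(_ Oa)[]]. Qed.

Lemma mem_pidl a : O a -> pidl a a.
Proof. by move=> Oa; rewrite pidlE //; exists 1; rewrite ?mulr1 //; exact: ringint1. Qed.

Lemma pidl_sub a I : I a -> forall x, pidl a x -> I x.
Proof.
by move=> Ia x; rewrite (pidlE (idl_sub Ia)) => -[y Oy ->]; rewrite mulrC; apply: idlM.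
Qed.

Lemma pidlM a b : O a -> O b -> pidl (a * b) = pidl a * pidl b.
Proof.
move=> Oa Ob; apply: idl_eq => x; split.
  by apply: pidl_sub; apply: mem_ideal_mul; apply: mem_pidl.
apply: ideal_mul_sub => c e; rewrite (pidlE (ringintM Oa Ob)) !pidlE //.
move=> -[y Oy ->] [z Oz ->].
by exists (y * z); rewrite 1?mulrACA //; apply: ringintM.
Qed.

Lemma pidlX a n : O a -> pidl (a ^+ n) = pidl a ^+ n.
Proof.
move=> Oa; elim: n => [|n IHn]; last by rewrite !exprS pidlM ?IHn //; apply: ringintX.
by apply/idl_eq1/mem_pidl; exact: ringint1.
Qed.

Lemma pidl1 : pidl 1 = 1.
Proof. by rewrite -(expr0 1) pidlX. Qed.

Lemma mem_pidlM a I x : O a -> (pidl a * I)%R x -> exists2 y, I y & x = a * y.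
Proof.
move=> Oa [s aIs ->]; elim: s aIs => [|[b c] s IHs] aIs.
  by exists 0; rewrite ?big_nil ?mulr0 //; apply: idl0.
have [|y Iy eqy] := IHs; first by move=> t ts; apply: aIs; rewrite inE ts orbT.
have [/=] := aIs _ (mem_head _ _); rewrite pidlE // => -[z Oz ->] Ic.
exists (z * c + y); first by apply: idlD => //; apply: idlM.
by rewrite big_cons eqy /= mulrDr mulrA.
Qed.

Lemma pidl_inj a I J : O a -> a != 0 -> pidl a * I = pidl a * J -> I = J.
Proof.
move=> Oa a0; wlog suff: I J / forall x, pidl a * I = pidl a * J -> I x -> J x.
  by move=> H eqIJ; apply: idl_eq => x; split; apply: H.
move=> x eqIJ Ix; have: (pidl a * I)%R (a * x).
  by apply: mem_ideal_mul => //; apply: mem_pidl.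
by rewrite eqIJ => /(mem_pidlM Oa)[y Jy /(mulfI a0)->].
Qed.

Definition nz_idl I := exists2 x, I x & x != 0.

Lemma nz_idlM I J : nz_idl I -> nz_idl J -> nz_idl (I * J).
Proof.
move=> [x Ix x0] [y Jy y0]; exists (x * y); last by rewrite mulf_neq0.
exact: mem_ideal_mul.
Qed.

Lemma nz_idl1 : nz_idl 1.
Proof. by exists 1; rewrite ?oner_eq0 //; exact: ringint1. Qed.

Lemma nz_idlX I n : nz_idl I -> nz_idl (I ^+ n).
Proof.
move=> nzI; elim: n => [|n IHn]; first exact: nz_idl1.
by rewrite exprS; apply: nz_idlM.
Qed.

Lemma nz_idlS I J : (forall x, I x -> J x) -> nz_idl I -> nz_idl J.
Proof. by move=> sIJ [x /sIJ Jx x0]; exists x. Qed.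

Lemma nz_pidl a : O a -> a != 0 -> nz_idl (pidl a).
Proof. by exists a => //; apply: mem_pidl. Qed.

End IdealSemiring.

(** * Prime ideals and factorization *)

Definition sub_idl (F : fieldType) (I J : idl F) := forall x, I x -> J x.

(** The facts from which factorization is derived: cancellation, Noetherian induction,
    divisibility of an ideal by those that contain it, and the fact that F is the
    field of fractions of its ring of integers. *)
Record dedekind (F : fieldType) : Prop := Dedekind {
  dedekind_mulI : forall I J L : idl F, nz_idl I -> I * J = I * L -> J = L;
  dedekind_ACC : forall P : idl F -> Prop,
    (forall I, nz_idl I -> (forall J, sub_idl I J -> J <> I -> P J) -> P I) ->
    forall I, nz_idl I -> P I;
  dedekind_dvd : forall I J : idl F, nz_idl I -> sub_idl J I -> exists J', J = I * J';
  dedekind_frac : forall x : F, exists b,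
    [/\ ring_of_integers b, b != 0 & ring_of_integers (b * x)] }.

Section Primes.
Variables (F : fieldType) (ded : dedekind F).
Local Notation O := (@ring_of_integers F).
Implicit Types I J A B C S T P Q : idl F.

Lemma prime_nz P : prime_ideal P -> nz_idl P.
Proof. by case=> -[]. Qed.

Lemma prime_neq1 P : prime_ideal P -> ~ sub_idl 1 P.
Proof. by case=> _ P1 _ sub; apply/P1/sub; exact: ringint1. Qed.

Lemma prime_mul P I J : prime_ideal P -> sub_idl (I * J) P -> sub_idl I P \/ sub_idl J P.
Proof.
move=> [_ _ primeP] sub; have [|nIP] := pselect (sub_idl I P); [by left|right=> b Jb].
have /existsNP[a /not_implyP[Ia nPa]] := nIP.
by case: (primeP a b (idl_sub Ia) (idl_sub Jb) (sub _ (mem_ideal_mul Ia Jb))).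
Qed.

Lemma prime_exp P I n : prime_ideal P -> sub_idl (I ^+ n) P -> sub_idl I P.
Proof.
move=> pP; elim: n => [/(prime_neq1 pP)//|n IHn].
by rewrite exprS => /(prime_mul pP)[].
Qed.

Lemma sub_pidl a I : I a -> sub_idl (pidl a) I.
Proof. by move=> Ia x; apply: pidl_sub. Qed.

Lemma sub_pidlE a I : O a -> sub_idl (pidl a) I -> I a.
Proof. by move=> Oa; apply; apply: mem_pidl. Qed.

(** If I is not prime, witnessed by a * b in I, then I + (a) is larger than I, and
    it is proper because 1 in I + (a) would imply b in I. *)
Lemma exists_prime I : nz_idl I -> I <> 1 ->
  exists2 P : idl F, prime_ideal P & sub_idl I P.
Proof.
move: I; apply: (dedekind_ACC ded) => I nzI IH I1.
have [pI|npI] := pselect (prime_ideal I); first by exists I.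
have nI1 : ~ I 1 by move/idl_eq1.
suff [a [b [Oa Ob Iab [nIa nIb]]]] :
    exists a b, [/\ O a, O b, I (a * b) & ~ I a /\ ~ I b].
  have sIJ : sub_idl I (I + pidl a) by move=> x; apply: mem_add_idll.
  have Ja : (I + pidl a)%R a by apply/mem_add_idlr/mem_pidl.
  have [|E|P pP sJP] := IH _ sIJ; first by move=> E; apply: nIa; rewrite -E.
    have : (I + pidl a)%R 1 by rewrite E; exact: ringint1.
    move=> [x [y [Ix]]]; rewrite pidlE // => -[z Oz ->] E1.
    case: nIb; rewrite -[b]mul1r E1 mulrDl mulrAC; apply: idlD; first exact: idlMr.
    exact: idlMr.
  by exists P => // x /sIJ/sJP.
apply: contrapT => H; apply: npI; split=> // [|a b Oa Ob Iab].
  by split=> //; exact: idlP.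
apply: contrapT => /not_orP[nIa nIb]; apply: H; exists a, b; split=> //.
Qed.

(** Q divides P, say P = Q J.  If P contains J then P divides J and cancelling P
    makes Q invertible; so P contains Q. *)
Lemma prime_maximal P Q : prime_ideal P -> prime_ideal Q -> sub_idl P Q -> P = Q.
Proof.
move=> pP pQ sPQ; have nzP := prime_nz pP.
have [J EP] := dedekind_dvd ded (prime_nz pQ) sPQ.
have sQJP : sub_idl (Q * J) P by rewrite -EP.
have [sQP|sJP] := prime_mul pP sQJP.
  by apply: idl_eq => x; split; [apply: sPQ | apply: sQP].
have [L EJ] := dedekind_dvd ded nzP sJP.
case: (prime_neq1 pQ) => x.
have -> : 1 = Q * L; last exact: idl_mull.
by apply: (dedekind_mulI ded nzP); rewrite mulr1 {1}EP EJ mulrCA.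
Qed.

Lemma prime_factor P I : prime_ideal P -> nz_idl I ->
  exists n J, I = P ^+ n * J /\ ~ sub_idl J P.
Proof.
move=> pP; move: I; apply: (dedekind_ACC ded) => I nzI IH.
have [sIP|nsIP] := pselect (sub_idl I P); last first.
  by exists 0%N, I; rewrite expr0 mul1r.
have nzP := prime_nz pP.
have [J EI] := dedekind_dvd ded nzP sIP.
have [||n [L [EJ nsL]]] := IH J.
- by rewrite EI; apply: idl_mulr.
- move=> EJ; case: (prime_neq1 pP) => x; have -> : 1 = P :> idl F; last by [].
  apply: (dedekind_mulI ded nzI); rewrite mulr1 {1}EI EJ; exact: mulrC.
- by exists n.+1, L; rewrite exprS -mulrA -EJ.
Qed.

Lemma prime_exp_uniq P n m I J : prime_ideal P ->
  ~ sub_idl I P -> ~ sub_idl J P -> P ^+ n * I = P ^+ m * J -> n = m.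
Proof.
move=> pP; wlog le_nm : n m I J / (n <= m)%N.
  move=> H nI nJ E; case/orP: (leq_total n m) => le; first exact: (H _ _ I J).
  by symmetry; apply: (H _ _ J I).
move=> nI _ /eqP; rewrite -(subnKC le_nm) exprD -mulrA.
move=> /eqP/(dedekind_mulI ded (nz_idlX n (prime_nz pP))).
case: (m - n)%N => [|k] EI; first by rewrite addn0.
by case: nI; rewrite EI exprS -mulrA => x; apply: idl_mull.
Qed.

(** The local hypothesis says that v_P (B) is divisible by e for every P other than
    P0.  It is phrased with ideals prime to P in the role of local units, so that
    it passes to the quotient of B by a power of a prime and the result follows by
    Noetherian induction. *)
Lemma descent P0 e B : prime_ideal P0 -> nz_idl B ->
  (forall P : idl F, prime_ideal P -> P <> P0 ->
    exists A C S T, [/\ nz_idl A, nz_idl C, ~ sub_idl S P, ~ sub_idl T P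
                       & B * A ^+ e * S = T * C ^+ e]) ->
  exists k J, nz_idl J /\ B = P0 ^+ k * J ^+ e.
Proof.
move=> pP0; move: B; apply: (dedekind_ACC ded) => B nzB IH HB.
have [->|B1] := pselect (B = 1).
  by exists 0%N, 1; rewrite expr0 expr1n mulr1; split => //; apply: nz_idl1.
have [P pP sBP] := exists_prime nzB B1.
have nzP := prime_nz pP.
have [EP|nEP] := pselect (P = P0).
  have [B' EB] := dedekind_dvd ded nzP sBP; rewrite EP in EB.
  have [||Q pQ nQ|k [J [nzJ EB']]] := IH B'.
  - by rewrite EB; apply: idl_mulr.
  - move=> EB'; case: (prime_neq1 pP0) => x; have -> : 1 = P0 :> idl F; last by [].
    apply: (dedekind_mulI ded nzB); rewrite mulr1 {1}EB EB'; exact: mulrC.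
  - have [A [C [S [T [nzA nzC nS nT E]]]]] := HB Q pQ nQ.
    exists A, C, (P0 * S), T; split=> //; last by rewrite -E EB; ring.
    by move=> /(prime_mul pQ)[|//] /(prime_maximal pP0 pQ)/esym.
  - by exists k.+1, J; split=> //; rewrite exprS -mulrA -EB'.
have [A [C [S [T [nzA nzC nS nT E]]]]] := HB P pP nEP.
have [n [B' [EB nB']]] := prime_factor pP nzB.
have [a [A' [EA nA']]] := prime_factor pP nzA.
have [c [C' [EC nC']]] := prime_factor pP nzC.
have npM X Y : ~ sub_idl X P -> ~ sub_idl Y P -> ~ sub_idl (X * Y) P.
  by move=> nX nY /(prime_mul pP)[].
have npX X k : ~ sub_idl X P -> ~ sub_idl (X ^+ k) P by move=> nX /(prime_exp pP).
have En : (n + a * e = c * e)%N.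
  apply: (@prime_exp_uniq P _ _ (B' * A' ^+ e * S) (T * C' ^+ e) pP).
  - by apply: (npM) => //; apply: (npM) => //; apply: npX.
  - by apply: (npM) => //; apply: npX.
  - by rewrite [RHS]mulrCA !exprM -exprMn -EC -E EB EA exprD exprMn exprM; ring.
have {}En : (n = (c - a) * e)%N by rewrite mulnBl -En addnK.
have n_gt0 : (0 < n)%N.
  by rewrite lt0n; apply/eqP=> n0; rewrite EB n0 mul1r in sBP.
have [||Q pQ nQ|k [J [nzJ EB']]] := IH B'.
- by rewrite EB; apply: idl_mulr.
- move=> EB'; case: (prime_neq1 pP) => x; have -> : 1 = P ^+ n.
    apply: (dedekind_mulI ded nzB); rewrite mulr1 {1}EB EB'; exact: mulrC.
  by rewrite -(prednK n_gt0) exprS; apply: idl_mull.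
- (* B' is prime to P, and P ^+ n is prime to any other Q. *)
  have [->|nQP] := pselect (Q = P).
    exists 1, 1, 1, B'; split; [exact: nz_idl1|exact: nz_idl1|exact: prime_neq1|by []|].
    by rewrite mulr1.
  have [A1 [C1 [S1 [T1 [nzA1 nzC1 nS1 nT1 E1]]]]] := HB Q pQ nQ.
  exists A1, C1, (P ^+ n * S1), T1; split=> //; last by rewrite -E1 EB; ring.
  move=> /(prime_mul pQ)[|//] /(prime_exp pQ)/(prime_maximal pP pQ)/esym//.
- exists k, (P ^+ (c - a) * J); split; first by apply: nz_idlM => //; apply: nz_idlX.
  by rewrite exprMn -exprM -En mulrCA -EB'.
Qed.

(** * The ideal class group *)

(** [ideal_equiv] in terms of the semiring of ideals. *)
Definition idl_equiv I J := exists a b : F,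
  [/\ O a, O b, a != 0, b != 0 & pidl a * I = pidl b * J].

Lemma ideal_equivE I J : ideal_equiv I J <-> idl_equiv I J.
Proof.
split=> -[a [b [Oa Ob a0 b0 E]]]; exists a, b; split=> //.
  by apply: idl_eq => x; rewrite !idl_setM !pidlE //= E.
by rewrite -!pidlE // -!idl_setM E.
Qed.

Lemma idl_equiv_refl I : idl_equiv I I.
Proof. by exists 1, 1; split; rewrite ?oner_eq0. Qed.

Lemma idl_equiv_sym I J : idl_equiv I J -> idl_equiv J I.
Proof. by move=> [a [b [Oa Ob a0 b0 E]]]; exists b, a. Qed.

Lemma idl_equiv_trans I J L : idl_equiv I J -> idl_equiv J L -> idl_equiv I L.
Proof.
move=> [a [b [Oa Ob a0 b0 E]]] [a' [b' [Oa' Ob' a0' b0' E']]].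
exists (a' * a), (b * b'); split; rewrite ?mulf_neq0 //; try exact: ringintM.
by rewrite !pidlM // -mulrA E mulrCA E' mulrA.
Qed.

Lemma idl_equivMl L I J : idl_equiv I J -> idl_equiv (L * I) (L * J).
Proof.
move=> [a [b [Oa Ob a0 b0 E]]]; exists a, b; split=> //.
by rewrite mulrCA E mulrCA.
Qed.

Lemma idl_equivIl L I J : nz_idl L -> idl_equiv (L * I) (L * J) -> idl_equiv I J.
Proof.
move=> nzL [a [b [Oa Ob a0 b0 E]]]; exists a, b; split=> //.
by apply: (dedekind_mulI ded nzL); rewrite mulrCA E mulrCA.
Qed.

Lemma idl_equiv1P I : idl_equiv I 1 -> exists2 g, O g & I = pidl g.
Proof.
move=> [a [b [Oa Ob a0 b0 E]]]; have : (pidl a * I)%R b by rewrite E mulr1; apply: mem_pidl.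
move=> /(mem_pidlM Oa)[g Ig Eb]; have Og := idl_sub Ig; exists g => //.
by apply: (pidl_inj Oa a0); rewrite E mulr1 Eb pidlM.
Qed.

Lemma idl_equiv_pidl a : O a -> a != 0 -> idl_equiv (pidl a) 1.
Proof. by move=> Oa a0; exists 1, a; split; rewrite ?oner_eq0 // pidl1 mulrC. Qed.

Lemma odd_involution_fixpoint n (f : 'I_n -> 'I_n) :
  odd n -> involutive f -> exists i, f i = i.
Proof.
move=> odd_n fK; suff /existsP[i /eqP fi] : [exists i, f i == i] by exists i.
apply: contraLR odd_n => /existsPn fn.
have inj_f := inv_inj fK; rewrite -dvdn2 -[n]card_ord.
have card2 : (fcard f predT * 2)%N = #|'I_n|.
  apply: (fcard_order_set inj_f) => //.
  apply/fintype.subsetP=> i _; rewrite inE (@order_cycle _ _ [:: i; f i]) ?inE ?eqxx //=.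
    by rewrite fK !eqxx.
  by rewrite inE eq_sym fn.
by rewrite -card2 dvdn_mull.
Qed.

(** Multiplication by I permutes the h classes and is an involution.  As h is odd
    it fixes some class, which can be cancelled. *)
Lemma sqr_class_odd h I : is_class_number F h -> odd h -> nz_idl I ->
  idl_equiv (I * I) 1 -> idl_equiv I 1.
Proof.
move=> [c nz_c Hc] odd_h nzI EI.
pose c' i := Idl (nz_c i).1.
have nz_c' i : nz_idl (c' i) by case: (nz_c i).
have {}Hc J : nz_idl J -> exists! i, idl_equiv J (c' i).
  move=> nzJ; have [|i [Ei Ui]] := Hc J; first by split=> //; apply: idlP.
  by exists i; split=> [|j /ideal_equivE Ej]; [exact/ideal_equivE|exact: Ui].
have nzIc i : nz_idl (I * c' i) by apply: nz_idlM.
pose f i := sval (cid (Hc _ (nzIc i))).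
have fE i : idl_equiv (I * c' i) (c' (f i)) by rewrite /f; case: cid => j [].
have c'_inj i j : idl_equiv (c' i) (c' j) -> i = j.
  have [k [_ Uk]] := Hc _ (nz_c' i); move=> /Uk <-.
  by symmetry; apply/Uk/idl_equiv_refl.
have [|i fi] := odd_involution_fixpoint odd_h (_ : involutive f).
  move=> i; apply: c'_inj; apply: idl_equiv_trans (idl_equiv_sym (fE (f i))) _.
  apply: idl_equiv_trans (idl_equivMl I (idl_equiv_sym (fE i))) _.
  have -> : I * (I * c' i) = c' i * (I * I) by rewrite mulrA mulrC.
  by rewrite -[X in idl_equiv _ X]mulr1; apply: idl_equivMl.
apply: (idl_equivIl (nz_c' i)); rewrite mulr1 mulrC -[X in idl_equiv _ (c' X)]fi.
exact: fE.
Qed.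

(** * Elements that are local units away from one prime *)

Variables (q : F) (Oq : O q) (q0 : q != 0) (prime_q : prime_ideal (pidl q)).

(** No prime other than (q) contains the ideal of denominators of x, which is
    therefore (q)^k; so q^k x lies in O, and it generates a power of (q) for the
    same reason.  Both times [descent] is used with exponent 0. *)
Lemma unit_away_frac x : x != 0 ->
  (forall P : idl F, prime_ideal P -> P <> pidl q -> unit_at P x) ->
  exists (k l : nat) (e : F), [/\ O e, O e^-1 & q ^+ k * x = q ^+ l * e].
Proof.
move=> x0 ux; have x_frac P : prime_ideal P -> P <> pidl q ->
  exists a b, [/\ O a, O b, ~ P a, ~ P b & x = a / b].
  by move=> pP nPq; have [a [b [[Oa nPa] [Ob nPb] E]]] := ux P pP nPq; exists a, b.
have iI : is_ideal [set y | O y /\ O (y * x)]%classic.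
  split; rewrite /mkset.
  - by move=> y [].
  - by rewrite mul0r.
  - by move=> y z [Oy Oyx] [Oz Ozx]; rewrite mulrDl; split; apply: ringintD.
  - by move=> a y Oa [Oy Oyx]; rewrite -mulrA; split; apply: ringintM.
have [||k [J [_ EI]]] := @descent _ 0 (Idl iI) prime_q.
- have [b [Ob b0 Obx]] := dedekind_frac ded x; by exists b.
- move=> P pP nPq; exists 1, 1, 1, (Idl iI).
  split; rewrite ?mulr1 ?expr0 //; try exact: nz_idl1; first exact: prime_neq1.
  have [a [b [Oa Ob nPa nPb E]]] := x_frac P pP nPq.
  move=> /(_ b) H; apply/nPb/H; split=> //; rewrite E mulrC divfK //.
  by apply: contra_notN nPb => /eqP->; apply: idl0.
rewrite expr0 mulr1 in EI.
have [Oqk Oqkx] : Idl iI (q ^+ k).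
  by rewrite EI -pidlX //; apply: mem_pidl; apply: ringintX.
have qkx0 : q ^+ k * x != 0 by rewrite mulf_neq0 // expf_neq0.
have [||l [J' [_ EqJ]]] := @descent _ 0 (pidl (q ^+ k * x)) prime_q.
- exact: nz_pidl.
- move=> P pP nPq; have [a [b [Oa Ob nPa nPb E]]] := x_frac P pP nPq.
  exists 1, 1, (pidl b), (pidl (q ^+ k * a)); split; try exact: nz_idl1.
  + by move/(sub_pidlE Ob).
  + move/(sub_pidlE (ringintM Oqk Oa)) => Pqa.
    have [_ _ primeP] := pP; case: (primeP _ _ Oqk Oa Pqa) => // Pqk.
    apply: nPq; symmetry; apply: prime_maximal => //; apply: (@prime_exp _ _ k) => //.
    by rewrite -pidlX //; apply: sub_pidl.
  + rewrite !expr0 !mulr1 -pidlM //; congr pidl; rewrite E -mulrA divfK //.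
    by apply: contra_notN nPb => /eqP->; apply: idl0.
exists k, l; rewrite expr0 mulr1 -pidlX // in EqJ.
have Oql : O (q ^+ l) by apply: ringintX.
have ql0 : q ^+ l != 0 by rewrite expf_neq0.
have : pidl (q ^+ l) (q ^+ k * x) by rewrite -EqJ; apply: mem_pidl.
rewrite pidlE // => -[e Oe Ee]; exists e; split=> //.
have : pidl (q ^+ k * x) (q ^+ l) by rewrite EqJ; apply: mem_pidl.
rewrite pidlE // => -[e' Oe' Ee']; suff -> : e^-1 = e' by [].
have e0 : e != 0 by apply: contraNneq qkx0 => e0; rewrite Ee e0 mulr0.
apply: (mulfI ql0); apply: (mulfI e0).
by rewrite mulrCA divff // mulr1 {1}Ee' Ee; ring.
Qed.

(** [descent] gives (n^4 x) = (q)^k J^4, where n is a denominator of x, and J is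
    principal because the class number is odd. *)
Lemma fourth_power_away h x : is_class_number F h -> odd h -> x != 0 ->
  (forall P : idl F, prime_ideal P -> P <> pidl q ->
    exists2 u, u != 0 & unit_at P (x / u ^+ 4)) ->
  exists (k : nat) (g e : F), [/\ g != 0, O e, O e^-1 & x = q ^+ k * e * g ^+ 4].
Proof.
move=> hh odd_h x0 Hx; have [n [On n0 Onx]] := dedekind_frac ded x.
pose y := n ^+ 4 * x.
have Oy : O y by rewrite /y exprSr -mulrA; apply: ringintM => //; apply: ringintX.
have y0 : y != 0 by rewrite mulf_neq0 // expf_neq0.
have [||k [J [nzJ EJ]]] := @descent _ 4 (pidl y) prime_q; first exact: nz_pidl.
  move=> P pP nPq; have [u u0 [a [b [[Oa nPa] [Ob nPb] E]]]] := Hx P pP nPq.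
  have [m [Om m0 Omu]] := dedekind_frac ded u.
  have nu0 : n * (m * u) != 0 by rewrite !mulf_neq0.
  exists (pidl m), (pidl (n * (m * u))), (pidl b), (pidl a).
  have Onmu : O (n * (m * u)) by apply: ringintM.
  split; try exact: nz_pidl.
  - by move/(sub_pidlE Ob).
  - by move/(sub_pidlE Oa).
  - rewrite -!pidlX // -!pidlM //;
      try by [apply: ringintX|apply: ringintM => //; apply: ringintX].
    congr pidl; rewrite /y; have b0 : b != 0.
      by apply: contra_notN nPb => /eqP->; apply: idl0.
    have -> : x = a / b * u ^+ 4 by rewrite -E divfK // expf_neq0.
    by field.
have qk0 : q ^+ k != 0 by rewrite expf_neq0.
have Oqk : O (q ^+ k) by apply: ringintX.
have EJ1 : idl_equiv (J ^+ 4) 1.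
  apply: (@idl_equivIl (pidl (q ^+ k))); first exact: nz_pidl.
  rewrite pidlX // -EJ mulr1 -pidlX //.
  exact: idl_equiv_trans (idl_equiv_pidl Oy y0) (idl_equiv_sym (idl_equiv_pidl _ _)).
have {}EJ1 : idl_equiv J 1.
  apply: (sqr_class_odd hh odd_h nzJ); apply: (sqr_class_odd hh odd_h).
    exact: nz_idlM.
  by rewrite -expr2 -expr2 -exprM.
have [g Og EJg] := idl_equiv1P EJ1.
have Og4 : O (g ^+ 4) by apply: ringintX.
rewrite EJg -!pidlX // -pidlM // in EJ.
have Oqg := ringintM Oqk Og4.
have : pidl (q ^+ k * g ^+ 4) y by rewrite -EJ; apply: mem_pidl.
rewrite pidlE // => -[e Oe Ee].
have [e0 g40] : e != 0 /\ g ^+ 4 != 0.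
  apply/andP; apply: contraNT y0; rewrite negb_and !negbK Ee.
  by move=> /orP[]/eqP->; rewrite ?mulr0 ?mul0r.
have g0 : g != 0 by apply: contraNneq g40 => ->; rewrite expr0n.
exists k, (g / n), e; split => //; first by rewrite mulf_neq0 ?invr_eq0.
  have : pidl y (q ^+ k * g ^+ 4) by rewrite EJ; apply: mem_pidl.
  rewrite pidlE // => -[e' Oe' Ee']; suff -> : e^-1 = e' by [].
  apply: (mulfI y0); rewrite -Ee' Ee; by field.
have -> : x = y / n ^+ 4 by rewrite /y mulrC mulKf // expf_neq0.
by rewrite Ee; field.
Qed.
End Primes.

(** * Local rings *)

Section LocalRing.
Variables (F : fieldType) (P : idl F).
Hypothesis pP : prime_ideal P.
Local Notation O := (@ring_of_integers F).

Lemma primeM a b : O a -> O b -> ~ P a -> ~ P b -> ~ P (a * b).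
Proof. by case: pP => _ _ H Oa Ob nPa nPb /(H _ _ Oa Ob)[]. Qed.

Lemma notin_prime_neq0 b : ~ P b -> b != 0.
Proof. by move=> nPb; apply: contra_notN nPb => /eqP->; apply: idl0. Qed.

Lemma integral_at_O x : O x -> integral_at P x.
Proof.
case: pP => _ nP1 _ Ox; exists x, 1; split=> //; by rewrite divr1.
Qed.

Lemma integral_at_div x b : O x -> O b -> ~ P b -> integral_at P (x / b).
Proof. by exists x, b. Qed.

Lemma integral_atD x y : integral_at P x -> integral_at P y -> integral_at P (x + y).
Proof.
move=> [a [b [Oa Ob nPb ->]]] [c [e [Oc Oe nPe ->]]].
have b0 := notin_prime_neq0 nPb; have e0 := notin_prime_neq0 nPe.
rewrite addf_div //; apply: integral_at_div; last exact: primeM.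
  by apply: ringintD; apply: ringintM.
exact: ringintM.
Qed.

Lemma integral_atM x y : integral_at P x -> integral_at P y -> integral_at P (x * y).
Proof.
move=> [a [b [Oa Ob nPb ->]]] [c [e [Oc Oe nPe ->]]].
by rewrite mulf_div; apply: integral_at_div;
  [exact: ringintM|exact: ringintM|exact: primeM].
Qed.

Lemma integral_atN x : integral_at P x -> integral_at P (- x).
Proof.
move=> [a [b [Oa Ob nPb ->]]]; rewrite -mulNr.
by apply: integral_at_div => //; apply: ringintN.
Qed.

Lemma integral_at_nat n : integral_at P n%:R.
Proof. exact: integral_at_O. Qed.

Lemma integral_atX x n : integral_at P x -> integral_at P (x ^+ n).
Proof.
move=> Ix; elim: n => [|n IHn]; first exact: (integral_at_nat 1).
by rewrite exprS; apply: integral_atM.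
Qed.

(** The local ring is integrally closed: with s a common denominator of the
    coefficients, s * x satisfies a monic equation over O. *)
Lemma integral_at_cubic x a b c :
  integral_at P a -> integral_at P b -> integral_at P c ->
  x ^+ 3 + a * x ^+ 2 + b * x + c = 0 -> integral_at P x.
Proof.
move=> [a1 [a2 [Oa1 Oa2 nPa2 Ea]]] [b1 [b2 [Ob1 Ob2 nPb2 Eb]]].
move=> [c1 [c2 [Oc1 Oc2 nPc2 Ec]]] Ex.
have a20 := notin_prime_neq0 nPa2; have b20 := notin_prime_neq0 nPb2.
have c20 := notin_prime_neq0 nPc2.
pose s := a2 * b2 * c2.
have Os : O s by do 2![apply: ringintM => //].
have nPs : ~ P s by do 2?[apply: primeM => //; try apply: ringintM => //].
have s0 := notin_prime_neq0 nPs.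
suff Osx : O (s * x) by rewrite -(mulKf s0 x) mulrC; apply: integral_at_div.
apply: (@ringint_monic_root _ [:: s ^+ 3 * c; s ^+ 2 * b; s * a]).
  have Osa : O (s * a).
    have -> : s * a = a1 * b2 * c2 by rewrite Ea /s; field.
    by do 2![apply: ringintM => //].
  have Osb : O (s * b).
    have -> : s * b = b1 * a2 * c2 by rewrite Eb /s; field.
    by do 2![apply: ringintM => //].
  have Osc : O (s * c).
    have -> : s * c = c1 * a2 * b2 by rewrite Ec /s; field.
    by do 2![apply: ringintM => //].
  move=> y; rewrite !inE => /or3P[]/eqP-> //.
    by rewrite exprSr -mulrA; apply: ringintM => //; apply: ringintX.
  by rewrite expr2 -mulrA; apply: ringintM.
rewrite horner_Poly /=; transitivity (s ^+ 3 * (x ^+ 3 + a * x ^+ 2 + b * x + c)).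
  by ring.
by rewrite Ex mulr0.
Qed.

Lemma unit_atM x y : unit_at P x -> unit_at P y -> unit_at P (x * y).
Proof.
move=> [a [b [[Oa nPa] [Ob nPb] ->]]] [c [e [[Oc nPc] [Oe nPe] ->]]].
exists (a * c), (b * e); split; last exact: mulf_div.
  by split; [exact: ringintM|exact: primeM].
by split; [exact: ringintM|exact: primeM].
Qed.

Lemma unit_atV x : unit_at P x -> unit_at P x^-1.
Proof. by move=> [a [b [Ha Hb ->]]]; exists b, a; rewrite invf_div. Qed.

Lemma unit_at_O x : O x -> ~ P x -> unit_at P x.
Proof. by case: pP => _ nP1 _ Ox nPx; exists x, 1; split; rewrite ?divr1. Qed.

Lemma unit_atX x n : unit_at P x -> unit_at P (x ^+ n).
Proof.
move=> Ux; elim: n => [|n IHn]; last by rewrite exprS; apply: unit_atM.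
by apply: unit_at_O; [exact: ringint1|case: pP].
Qed.

Lemma unit_at_unit e : e != 0 -> O e -> O e^-1 -> unit_at P e.
Proof.
move=> e0 Oe Oe'; apply: unit_at_O => // Pe; case: pP => _ nP1 _; apply: nP1.
by rewrite -(mulVf e0); apply: idlM.
Qed.

Lemma unit_at_mull x y : integral_at P x -> integral_at P y -> unit_at P (x * y) ->
  unit_at P x.
Proof.
move=> [a [b [Oa Ob nPb ->]]] [c [e [Oc Oe nPe ->]]] [f [g [[Of nPf] [Og nPg] E]]].
exists a, b; split=> //; split=> // Pa.
have b0 := notin_prime_neq0 nPb; have e0 := notin_prime_neq0 nPe.
have g0 := notin_prime_neq0 nPg.
have : ~ P (f * b * e) by do 2?[apply: primeM => //; try apply: ringintM => //].
apply; have -> : f * b * e = (c * g) * a.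
  have -> : f = a / b * (c / e) * g by rewrite E divfK.
  by field; rewrite b0 e0.
by apply: idlM => //; apply: ringintM.
Qed.

End LocalRing.

(** * Weierstrass equations *)

Section WeierstrassIso.
Variable F : fieldType.
Implicit Types W M : weierstrass F.

(** The discriminant is homogeneous of weight 12. *)
Lemma wdisc_iso W W' u r s t :
  [/\ u * wa1 W' = wa1 W + 2 * s,
        u ^+ 2 * wa2 W' = wa2 W - s * wa1 W + 3 * r - s ^+ 2,
        u ^+ 3 * wa3 W' = wa3 W + r * wa1 W + 2 * t,
        u ^+ 4 * wa4 W' = wa4 W - s * wa3 W + 2 * r * wa2 W
                          - (t + r * s) * wa1 W + 3 * r ^+ 2 - 2 * s * t
      & u ^+ 6 * wa6 W' = wa6 W + r * wa4 W + r ^+ 2 * wa2 W + r ^+ 3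
                          - t * wa3 W - t ^+ 2 - r * t * wa1 W] ->
  u ^+ 12 * wdisc W' = wdisc W.
Proof.
case: W W' => [a1 a2 a3 a4 a6] [a1' a2' a3' a4' a6'] /= [E1 E2 E3 E4 E6].
transitivity (wdisc (Weierstrass
  (u * a1') (u ^+ 2 * a2') (u ^+ 3 * a3') (u ^+ 4 * a4') (u ^+ 6 * a6'))).
  by rewrite /wdisc /wb2 /wb4 /wb6 /wb8 /=; ring.
by rewrite E1 E2 E3 E4 E6 /wdisc /wb2 /wb4 /wb6 /wb8 /=; ring.
Qed.

Lemma isomorphic_trans W W' W'' :
  isomorphic W W' -> isomorphic W' W'' -> isomorphic W W''.
Proof.
case: W W' W'' => [a1 a2 a3 a4 a6] [b1 b2 b3 b4 b6] [c1 c2 c3 c4 c6].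
move=> [u [r [s [t [u0 /= [E1 E2 E3 E4 E6]]]]]].
move=> [v [r' [s' [t' [v0 /= [D1 D2 D3 D4 D6]]]]]].
(* x = u^2 (v^2 x'' + r') + r, and likewise for y *)
exists (u * v), (u ^+ 2 * r' + r), (s + u * s'), (t + u ^+ 3 * t' + s * u ^+ 2 * r').
split; first by rewrite mulf_neq0.
split=> /=.
- rewrite -mulrA D1 mulrDr E1; ring.
- by transitivity (u ^+ 2 * (v ^+ 2 * c2)); first ring; rewrite D2;
  transitivity (u ^+ 2 * b2 - s' * u * (u * b1) + u ^+ 2 * (3 * r' - s' ^+ 2)); first ring;
  rewrite E2 E1; ring.
- transitivity (u ^+ 3 * (v ^+ 3 * c3)); first ring; rewrite D3.
  transitivity (u ^+ 3 * b3 + r' * u ^+ 2 * (u * b1) + u ^+ 3 * (2 * t')); first ring.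
  rewrite E3 E1; ring.
- transitivity (u ^+ 4 * (v ^+ 4 * c4)); first ring; rewrite D4.
  transitivity (u ^+ 4 * b4 - s' * u * (u ^+ 3 * b3) + 2 * r' * u ^+ 2 * (u ^+ 2 * b2)
     - (t' + r' * s') * u ^+ 3 * (u * b1)
     + u ^+ 4 * (3 * r' ^+ 2 - 2 * s' * t')); first ring.
  rewrite E4 E3 E2 E1; ring.
- transitivity (u ^+ 6 * (v ^+ 6 * c6)); first ring; rewrite D6.
  transitivity (u ^+ 6 * b6 + r' * u ^+ 2 * (u ^+ 4 * b4) + r' ^+ 2 * u ^+ 4 * (u ^+ 2 * b2)
     + u ^+ 6 * r' ^+ 3 - t' * u ^+ 3 * (u ^+ 3 * b3) - u ^+ 6 * t' ^+ 2
     - r' * t' * u ^+ 5 * (u * b1)); first ring.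
  rewrite E6 E4 E3 E2 E1; ring.
Qed.

Lemma isomorphic_sym W W' : isomorphic W W' -> isomorphic W' W.
Proof.
case: W W' => [a1 a2 a3 a4 a6] [b1 b2 b3 b4 b6] [u [r [s [t [u0 /= [E1 E2 E3 E4 E6]]]]]].
exists u^-1, (- r / u ^+ 2), (- s / u), ((r * s - t) / u ^+ 3).
split; first by rewrite invr_eq0.
have {}E1 : b1 = (a1 + 2 * s) / u by rewrite -E1; field.
have {}E2 : b2 = (a2 - s * a1 + 3 * r - s ^+ 2) / u ^+ 2 by rewrite -E2; field.
have {}E3 : b3 = (a3 + r * a1 + 2 * t) / u ^+ 3 by rewrite -E3; field.
have {}E4 : b4 = (a4 - s * a3 + 2 * r * a2 - (t + r * s) * a1 + 3 * r ^+ 2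
                  - 2 * s * t) / u ^+ 4
  by rewrite -E4; field.
have {}E6 : b6 = (a6 + r * a4 + r ^+ 2 * a2 + r ^+ 3 - t * a3 - t ^+ 2
                  - r * t * a1) / u ^+ 6
  by rewrite -E6; field.
by split; rewrite /= ?E1 ?E2 ?E3 ?E4 ?E6; field.
Qed.

(** The curve y^2 = x^3 + a x^2 + b x, on which the origin has order 2. *)
Definition torsion2_form (a b : F) : weierstrass F := Weierstrass 0 a 0 b 0.

Lemma wdisc_torsion2_form a b :
  wdisc (torsion2_form a b) = 16 * b ^+ 2 * (a ^+ 2 - 4 * b).
Proof. by rewrite /wdisc /wb2 /wb4 /wb6 /wb8 /=; ring. Qed.

Hypothesis two_neq0 : (2 : F) != 0.

(** A point (x, y) of order 2 satisfies 2 y + a1 x + a3 = 0: moving it to the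
    origin removes the term in y, and completing the square, with s = - a1 / 2,
    removes the term in x y. *)
Lemma isomorphic_torsion2_form W :
  (exists P : rat_point F, has_order W P 2) ->
  exists a b, isomorphic W (torsion2_form a b).
Proof.
case: W => [a1 a2 a3 a4 a6] [[[x y]|] [/= onW _ PP0 ord]]; last by have := ord 1%N isT.
have E2 : 2 * y + a1 * x + a3 = 0.
  move: PP0; rewrite /point_mul /= eqxx /=; case: eqP => // E _.
  by transitivity (y - (- y - a1 * x - a3)); [ring|rewrite -E subrr].
exists (a2 + a1 ^+ 2 / 4 + 3 * x), (a4 + a1 * a3 / 2 + 2 * x * a2
  - (y - x * a1 / 2) * a1 + 3 * x ^+ 2 + a1 * y).
have E4 : (4 : F) = 2 * 2 by ring.
have n4 : (4 : F) != 0 by rewrite E4 mulf_neq0.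
exists 1, x, (- a1 / 2), y; split; first exact: oner_neq0.
split=> /=.
- by field; rewrite ?n4 ?two_neq0.
- by field; rewrite ?n4 ?two_neq0.
- by rewrite expr1n mul1r -E2; ring.
- by field; rewrite ?n4 ?two_neq0.
- rewrite mulr0; move/eqP: onW => onW; symmetry.
  transitivity (x ^+ 3 + a2 * x ^+ 2 + a4 * x + a6
    - (y ^+ 2 + a1 * x * y + a3 * y)); first ring.
  by rewrite onW subrr.
Qed.

(** On M the 2-torsion point has abscissa rho = - r / u^2, a root of the 2-division
    polynomial 4 x^3 + b2 x^2 + 2 b4 x + b6, so 4 rho is a root of a monic cubic and
    rho is integral at P.  Then A = a / u^2 and B = b / u^4 are integral at P, and
    16 B^2 (A^2 - 4 B) is the discriminant of M, a unit. *)
Lemma torsion2_form_good (P : idl F) a b M : prime_ideal P -> ~ P 2 ->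
  isomorphic (torsion2_form a b) M -> integral_model P M -> unit_at P (wdisc M) ->
  exists2 u, u != 0 & unit_at P (b / u ^+ 4) /\ unit_at P ((a ^+ 2 - 4 * b) / u ^+ 4).
Proof.
move=> pP nP2 [u [r [s [t [u0 Eiso]]]]] intM unitM.
have Edisc := wdisc_iso Eiso; rewrite wdisc_torsion2_form in Edisc.
exists u => //; pose A := a / u ^+ 2; pose B := b / u ^+ 4; pose rho := - r / u ^+ 2.
have E4 : (4 : F) = 2 * 2 by ring.
have n4 : (4 : F) != 0 by rewrite E4 mulf_neq0.
have O2 : ring_of_integers (2 : F) by apply: ringint_nat.
have O4 : ring_of_integers (4 : F) by apply: ringint_nat.
have nP4 : ~ P 4 by rewrite E4; apply: primeM.
have I2 : integral_at P (2^-1).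
  by rewrite -div1r; apply: integral_at_div => //; exact: ringint1.
have I4 : integral_at P (4^-1).
  by rewrite -div1r; apply: integral_at_div => //; exact: ringint1.
have In := integral_at_nat pP.
have IM := integral_atM pP; have ID := integral_atD pP; have IN := @integral_atN _ P.
have IX := integral_atX pP.
case: M Eiso intM unitM Edisc => a1 a2 a3 a4 a6 /= [E1 E2 E3 E4' E6].
move=> [/= I1 I2' I3 I4' I6] unitM Edisc.
have {}E1 : a1 = 2 * s / u by apply: (mulfI u0); rewrite E1; field.
have {}E2 : a2 = (a + 3 * r - s ^+ 2) / u ^+ 2.
  by apply: (mulfI (expf_neq0 2 u0)); rewrite E2; field; rewrite ?n4 ?two_neq0 ?u0.
have {}E3 : a3 = 2 * t / u ^+ 3.
  by apply: (mulfI (expf_neq0 3 u0)); rewrite E3; field.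
have {}E4' : a4 = (b + 2 * r * a + 3 * r ^+ 2 - 2 * s * t) / u ^+ 4.
  by apply: (mulfI (expf_neq0 4 u0)); rewrite E4'; field; rewrite ?n4 ?two_neq0 ?u0.
have {}E6 : a6 = (r * b + r ^+ 2 * a + r ^+ 3 - t ^+ 2) / u ^+ 6.
  by apply: (mulfI (expf_neq0 6 u0)); rewrite E6; field; rewrite ?n4 ?two_neq0 ?u0.
have Irho : integral_at P rho.
  have -> : rho = 4 * rho / 4 by field; rewrite ?n4 ?two_neq0 ?u0.
  apply: (IM) => //; apply: (@integral_at_cubic _ _ pP _ (a1 ^+ 2 + 4 * a2)
    (4 * (2 * (2 * a4 + a1 * a3))) (16 * (a3 ^+ 2 + 4 * a6))).
  - by apply: (ID); [exact: IX|exact: IM].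
  - by apply: (IM) => //; apply: (IM) => //; apply: (ID); apply: IM.
  - by apply: (IM) => //; apply: (ID); [exact: IX|exact: IM].
  - by rewrite E1 E2 E3 E4' E6 /rho; field; rewrite ?n4 ?two_neq0 ?u0.
have IA : integral_at P A.
  have -> : A = a2 + (a1 * a1) / 4 + 3 * rho.
    by rewrite E1 E2 /A /rho; field; rewrite ?n4 ?u0.
  by apply: (ID); [apply: (ID) => //; apply: (IM) => //; exact: IM|exact: IM].
have IB : integral_at P B.
  have -> : B = a4 + 2 * rho * A + (- (3 * rho ^+ 2)) + a1 * a3 / 2.
    by rewrite E1 E3 E4' /B /A /rho; field; rewrite ?n4 ?two_neq0 ?u0.
  apply: (ID); last by apply: (IM) => //; exact: IM.
  apply: (ID); last by apply: (IN); apply: (IM) => //; exact: IX.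
  by apply: (ID) => //; apply: (IM) => //; exact: IM.
have Edisc' : wdisc (Weierstrass a1 a2 a3 a4 a6) = B * (B * (16 * (A ^+ 2 - 4 * B))).
  by apply: (mulfI (expf_neq0 12 u0)); rewrite Edisc /A /B; field.
have ED : (a ^+ 2 - 4 * b) / u ^+ 4 = A ^+ 2 - 4 * B by rewrite /A /B; field.
have ID' : integral_at P (A ^+ 2 - 4 * B).
  by apply: (ID); [exact: IX|apply: (IN); exact: IM].
rewrite ED -/B; rewrite Edisc' in unitM; split.
  by apply: (unit_at_mull pP IB _ unitM); apply: (IM) => //; exact: IM.
have {}unitM : unit_at P ((A ^+ 2 - 4 * B) * (16 * B ^+ 2)).
  by rewrite (_ : _ * _ = B * (B * (16 * (A ^+ 2 - 4 * B)))) //; ring.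
by apply: (unit_at_mull pP ID' _ unitM); apply: (IM) => //; exact: IX.
Qed.

End WeierstrassIso.

(** * The equation d c^2 = +-2^m +- 2^n *)

Lemma two_power_odd_part a b x y : odd x -> odd y -> (2 ^ a * x = 2 ^ b * y)%N -> x = y.
Proof.
have logn_odd k z : odd z -> logn 2 (2 ^ k * z) = k.
  move=> oz; rewrite lognM ?expn_gt0 ?(odd_gt0 oz) //.
  by rewrite pfactorK // lognE dvdn2 oz andbF addn0.
move=> ox oy E; have Eab : a = b by rewrite -(logn_odd a x) // E logn_odd.
by move: E; rewrite Eab => /eqP; rewrite eqn_pmul2l ?expn_gt0 // => /eqP.
Qed.

Section ModEight.
Variables (d : nat) (d3 : (3 < d)%N) (d8 : (d %% 8 = 3)%N).

(** Modulo 8 the left-hand side d c^2 is 3, whereas 2^r is 1, 2, 4 or 0; only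
    2^1 + 1 and 2^2 - 1 survive, and both are equal to 3 < d. *)
Lemma sqr_ne_two_powers_odd c r : odd c ->
  ~ (d * c ^ 2 = 2 ^ r + 1)%N /\ ~ (d * c ^ 2 + 1 = 2 ^ r)%N.
Proof.
move=> oc; have Ec : (c ^ 2 %% 8 = 1)%N.
  have : (c = (c./2).*2.+1)%N by rewrite -{1}[c]odd_double_half oc.
  move: c./2 => z ->; have : (z * z.+1 %% 2 = 0)%N by rewrite modn2 oddM /= andbN.
  nia.
have E8 : (d * c ^ 2 %% 8 = 3)%N by rewrite -modnMm Ec d8.
have c_gt0 : (0 < c ^ 2)%N by rewrite expn_gt0 odd_gt0.
have d_le : (3 < d * c ^ 2)%N by apply: leq_trans d3 _; rewrite leq_pmulr.
case: r => [|[|[|r]]]; split; try lia.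
  by rewrite !expnS; lia.
by rewrite !expnS; lia.
Qed.

Lemma sqr_ne_two_powers c m n : (0 < c)%N ->
  ~ (d * c ^ 2 = 2 ^ m + 2 ^ n)%N /\ ~ (d * c ^ 2 + 2 ^ n = 2 ^ m)%N.
Proof.
move=> c_gt0; have od : odd d by rewrite (divn_eq d 8) d8 oddD oddM andbF.
have [c' co_c' Ec] := pfactor_coprime (isT : prime 2) c_gt0.
have oc' : odd c' by rewrite -coprime2n.
have oL : odd (d * c' ^ 2) by rewrite oddM oddX oc' od.
have EL : (d * c ^ 2 = 2 ^ (logn 2 c * 2) * (d * c' ^ 2))%N.
  by rewrite {1}Ec expnMn mulnA -expnM mulnC.
have sum_ne k l : (k <= l)%N -> (d * c ^ 2 <> 2 ^ l + 2 ^ k)%N.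
  move=> le_kl; rewrite EL -(subnKC le_kl) expnD.
  case Er: (l - k)%N => [|r].
    rewrite muln1 addnn -mul2n -expnS -[(2 ^ k.+1)%N]muln1.
    move=> /(two_power_odd_part oL (isT : odd 1)); have := odd_gt0 oc'; nia.
  rewrite -[X in _ = (_ + X)%N]muln1 -mulnDr.
  have oR : odd (2 ^ r.+1 + 1) by rewrite oddD oddX.
  by move=> /(two_power_odd_part oL oR); case: (sqr_ne_two_powers_odd r.+1 oc').
split.
  by case/orP: (leq_total n m) => le_nm; [exact: sum_ne|rewrite addnC; exact: sum_ne].
move=> E; have lt_nm : (n < m)%N.
  have : (0 < d * c ^ 2)%N by rewrite EL muln_gt0 expn_gt0 (odd_gt0 oL).
  by rewrite -(ltn_exp2l n m (isT : 1 < 2)%N) -E; lia.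
have r_gt0 : (0 < m - n)%N by rewrite subn_gt0.
have oR : odd (2 ^ (m - n)).-1.
  rewrite -[odd _]negbK -oddS prednK ?expn_gt0 // oddX.
  by rewrite orbF -lt0n r_gt0.
have : (2 ^ (logn 2 c * 2) * (d * c' ^ 2) = 2 ^ n * (2 ^ (m - n)).-1)%N.
  rewrite -EL -subn1 mulnBr muln1 -expnD subnKC ?(ltnW lt_nm) // -E addnK //.
move=> /(two_power_odd_part oL oR) Eo.
by case: (sqr_ne_two_powers_odd (m - n) oc') => _; rewrite Eo addn1 prednK ?expn_gt0.
Qed.

End ModEight.

(** The square of the denominator of r divides d. *)
Lemma squarefree_rat_int d (r : rat) : squarefree d -> (0 < d)%N ->
  d%:R * r ^+ 2 \is a Num.int -> r \is a Num.int.
Proof.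
move=> sqf d_gt0 /intrP[m Em].
have co : coprime `|numq r| `|denq r| by apply: coprime_num_den.
have den0 : (denq r)%:~R != 0 :> rat by rewrite intr_eq0 denq_eq0.
have E : (d * `|numq r| ^ 2 = `|m| * `|denq r| ^ 2)%N.
  have : d%:Z * numq r ^+ 2 = m * denq r ^+ 2.
    apply/eqP; rewrite -(eqr_int rat) !expr2 !intrM -Em numqE -pmulrn; apply/eqP; ring.
  by rewrite !expr2 => /(congr1 absz); rewrite !abszM -!mulnn.
have : (`|denq r| ^ 2 %| d)%N.
  have cop : coprime (`|denq r| ^ 2) (`|numq r| ^ 2).
    by rewrite coprimeXl // coprimeXr // coprime_sym.
  by rewrite -(Gauss_dvdl d cop) E dvdn_mull.
move=> /sqf den1; rewrite -[r]divq_num_den.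
have -> : denq r = 1 by rewrite -(gez0_abs (denq_ge0 r)) den1.
by rewrite divr1 intr_int.
Qed.

Lemma rat_sqr_ne_two_powers d (q s s' : rat) i m n : squarefree d ->
  (3 < d)%N -> (d %% 8 = 3)%N -> q != 0 -> (s = 1 \/ s = -1) -> (s' = 1 \/ s' = -1) ->
  2 ^+ i * (d%:R * q ^+ 2) <> 2 ^+ m * s + 2 ^+ n * s'.
Proof.
move=> sqf d3 d8 q0 Hs Hs' E.
have /intrP[c Ec] : 2 ^+ i * q \is a Num.int.
  apply: (squarefree_rat_int sqf); first exact: leq_trans d3.
  rewrite (_ : _ * _ = 2 ^+ i * (2 ^+ i * (d%:R * q ^+ 2))); last by ring.
  rewrite E; case: Hs Hs' => -> [] ->; rewrite ?mulrN ?mulr1 -?natrX;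
    by do ?[apply: rpredM|apply: rpredD|rewrite rpredN]; exact: natr_int.
have c0 : (0 < `|c|)%N.
  rewrite absz_gt0 -(intr_eq0 rat) -Ec mulf_neq0 // expf_neq0 //.
have {}E : (d * `|c| ^ 2)%N%:R = 2 ^+ (i + m) * s + 2 ^+ (i + n) * s' :> rat.
  have -> : (d * `|c| ^ 2)%N%:R = d%:R * (2 ^+ i * q) ^+ 2 :> rat.
    by rewrite natrM natrX Ec natr_absz intr_norm real_normK // num_real.
  rewrite !exprD -!mulrA -mulrDr -E; ring.
have natE a b : (a%:R = b%:R :> rat) -> a = b by move=> /eqP; rewrite eqr_nat => /eqP.
have [ne_add ne_sub] := sqr_ne_two_powers d3 d8 (i + m) (i + n) c0.
have [_ ne_sub'] := sqr_ne_two_powers d3 d8 (i + n) (i + m) c0.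
move: E; case: Hs Hs' => -> [] ->; rewrite ?mulrN ?mulr1 => E.
- by apply/ne_add/natE; rewrite natrD !natrX.
- by apply/ne_sub/natE; rewrite natrD !natrX E subrK.
- by apply/ne_sub'/natE; rewrite natrD !natrX E addrAC addNr add0r.
- have : 0 <= (d * `|c| ^ 2)%N%:R :> rat by [].
  by rewrite E leNgt -opprD oppr_lt0 addr_gt0 // exprn_gt0.
Qed.

Arguments GRing.in_alg {_} A _ : simpl never.

(** * Quadratic fields *)

Lemma fext_nat_neq0 (K : fieldExtType rat) n : (n.+1%:R : K) != 0.
Proof. by rewrite -(rmorph_nat (in_alg K)) fmorph_eq0 pnatr_eq0. Qed.

(** The image of a in algC is a rational algebraic integer. *)
Lemma rat_integral_int (K : fieldExtType rat) (a : rat) :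
  ring_of_integers (in_alg K a) -> a \is a Num.int.
Proof.
move=> [p mon_p]; rewrite (_ : map_poly intr p = map_poly (in_alg K) (map_poly intr p)).
  rewrite fmorph_root => ra.
  suff: (ratr a : algC) \in Num.int.
    by move=> /intrP[m /eqP]; rewrite -ratr_int fmorph_eq => /eqP->; apply: intr_int.
  apply: Cint_rat_Aint; first exact: Crat_rat.
  apply: (@root_monic_Aint (map_poly (ratr \o intr) p)).
  - by rewrite map_poly_comp fmorph_root.
  - exact: monic_map.
  - by apply/polyOverP=> i; rewrite coef_map /= ratr_int intr_int.
by rewrite -map_poly_comp; apply: eq_map_poly => x; rewrite /= rmorph_int.
Qed.

Section QuadraticField.
Variables (d : nat) (d_gt0 : (0 < d)%N) (K : fieldExtType rat) (w : K).
Hypothesis sqr_w : w ^+ 2 = - d%:R.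
Hypothesis gen_w : <<1; w>>%VS = fullv.
Local Notation O := (@ring_of_integers K).
Local Notation ia := (in_alg K).

Lemma quad_coordP x : exists ab : rat * rat, x = ia ab.1 + ia ab.2 * w.
Proof.
pose S x := exists ab : rat * rat, x = ia ab.1 + ia ab.2 * w.
have SD y z : S y -> S z -> S (y + z).
  move=> [[a b] ->] [[a' b'] ->]; exists (a + a', b + b').
  rewrite /fst /snd !rmorphD /=; ring.
have SX n a : S (ia a * w ^+ n).
  have [k e ->] : exists2 k, (k == n %/ 2)%N & (n = odd n + k * 2)%N.
    by exists (n %/ 2)%N; rewrite // -modn2 addnC -divn_eq.
  have Ew : w ^+ (k * 2) = ia ((- d%:R) ^+ k).
    by rewrite mulnC exprM sqr_w rmorphXn rmorphN rmorph_nat.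
  rewrite exprD Ew; case: (odd n).
    exists (0, a * (- d%:R) ^+ k); rewrite /fst /snd [ia (a * _)]rmorphM rmorph0.
    by rewrite add0r -mulrA; congr (_ * _); exact: mulrC.
  exists (a * (- d%:R) ^+ k, 0); rewrite /fst /snd [ia (a * _)]rmorphM rmorph0.
  by rewrite mul0r addr0 mul1r.
have : x \in <<1; w>>%VS by rewrite gen_w memvf.
move/Fadjoin_polyP=> [p /polyOverP p1 ->]; rewrite horner_coef.
apply: (big_ind S) => [|//|i _]; first by exists (0, 0); rewrite !rmorph0 mul0r addr0.
by have /vlineP[a ->] := p1 i; apply: (SX).
Qed.

Definition qre x : rat := (sval (cid (quad_coordP x))).1.
Definition qim x : rat := (sval (cid (quad_coordP x))).2.

Lemma quadE x : x = ia (qre x) + ia (qim x) * w.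
Proof. by rewrite /qre /qim; case: cid. Qed.

Lemma quad_free a b : ia a + ia b * w = 0 -> a = 0 /\ b = 0.
Proof.
move=> ab0; have : ia (a ^+ 2 + d%:R * b ^+ 2) = 0.
  rewrite rmorphD rmorphM !rmorphXn rmorph_nat /=.
  have -> : in_alg K a = - (in_alg K b * w) by apply/eqP; rewrite -addr_eq0 ab0.
  have -> : d%:R = - w ^+ 2 by rewrite sqr_w opprK.
  ring.
move/eqP; rewrite fmorph_eq0 paddr_eq0 ?sqr_ge0 //; last first.
  by rewrite mulr_ge0 ?sqr_ge0 ?ler0n.
by rewrite sqrf_eq0 mulf_eq0 sqrf_eq0 pnatr_eq0 (gtn_eqF d_gt0) => /andP[/eqP-> /eqP->].
Qed.

Lemma quad_inj a b a' b' : ia a + ia b * w = ia a' + ia b' * w -> a = a' /\ b = b'.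
Proof.
move=> /eqP; rewrite -subr_eq0 => /eqP E.
have /quad_free[/eqP + /eqP] : ia (a - a') + ia (b - b') * w = 0.
  rewrite -E !rmorphB /=; ring.
by rewrite !subr_eq0 => /eqP-> /eqP->.
Qed.

Definition conj x : K := ia (qre x) - ia (qim x) * w.

Lemma conjE a b : conj (ia a + ia b * w) = ia a - ia b * w.
Proof. by rewrite /conj; have /quad_inj[<- <-] := quadE (ia a + ia b * w). Qed.

Lemma conj_rat a : conj (ia a) = ia a.
Proof. by have := conjE a 0; rewrite !rmorph0 mul0r addr0 subr0. Qed.

Fact conj_is_zmod_morphism : zmod_morphism conj.
Proof.
move=> x y; have -> : x - y = ia (qre x - qre y) + ia (qim x - qim y) * w.
  by rewrite {1}(quadE x) {1}(quadE y) !rmorphB /=; ring.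
by rewrite conjE /conj !rmorphB /=; ring.
Qed.

Fact conj_is_monoid_morphism : monoid_morphism conj.
Proof.
split=> [|x y]; first by rewrite -(rmorph1 ia) conj_rat.
have dE : d%:R = - w ^+ 2 by rewrite sqr_w opprK.
have -> : x * y = ia (qre x * qre y - d%:R * (qim x * qim y))
                  + ia (qre x * qim y + qim x * qre y) * w.
  rewrite {1}(quadE x) {1}(quadE y) !rmorphB !rmorphD !rmorphM rmorph_nat dE /=; ring.
by rewrite conjE /conj !rmorphB !rmorphD !rmorphM rmorph_nat dE /=; ring.
Qed.

HB.instance Definition _ :=
  GRing.isZmodMorphism.Build K K conj conj_is_zmod_morphism.
HB.instance Definition _ :=
  GRing.isMonoidMorphism.Build K K conj conj_is_monoid_morphism.

Lemma conjK : involutive conj.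
Proof.
move=> x; rewrite {2}/conj -mulNr -rmorphN conjE rmorphN mulNr opprK.
by rewrite [RHS](quadE x).
Qed.

Lemma conj_ringint x : O x -> O (conj x).
Proof.
move=> [p mon_p px]; exists p => //; move/rootP: px => px; apply/rootP.
have -> : map_poly intr p = map_poly conj (map_poly intr p).
  by rewrite -map_poly_comp; apply: eq_map_poly => z; rewrite /= rmorph_int.
by rewrite horner_map /= px rmorph0.
Qed.

(** Trace and norm, in terms of the coordinates on (1, w). *)
Definition qtr x : rat := qre x *+ 2.
Definition qnm x : rat := qre x ^+ 2 + d%:R * qim x ^+ 2.

Lemma qtrE x : x + conj x = ia (qtr x).
Proof. by rewrite {1}(quadE x) /conj /qtr rmorphMn /=; ring. Qed.

Lemma qnmE x : x * conj x = ia (qnm x).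
Proof.
have dE : d%:R = - w ^+ 2 by rewrite sqr_w opprK.
rewrite {1}(quadE x) /conj /qnm rmorphD rmorphXn rmorphM rmorphXn rmorph_nat dE /=.
by ring.
Qed.

Lemma ringint_int_rat (a : rat) : a \is a Num.int -> O (ia a).
Proof. by move=> /intrP[m ->]; rewrite rmorph_int; apply: ringint_int. Qed.

(** x is a root of X^2 - tr(x) X + N(x); conversely the conjugate of an integral
    element is integral, and so are the trace and the norm, which are rational. *)
Lemma ringint_quadP x : O x <-> (qtr x \is a Num.int /\ qnm x \is a Num.int).
Proof.
split=> [Ox|[/ringint_int_rat Ot /ringint_int_rat On]].
  have Ocx := conj_ringint Ox.
  by split; apply: (@rat_integral_int K); rewrite -?qtrE -?qnmE;
    [exact: ringintD|exact: ringintM].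
apply: (@ringint_monic_root _ [:: ia (qnm x); - ia (qtr x)]).
  by move=> c; rewrite !inE => /orP[]/eqP-> //; apply: ringintN.
rewrite horner_Poly /= -qtrE -qnmE; ring.
Qed.

Implicit Types I J : idl K.

Lemma is_ideal_conj I : is_ideal [set x | I (conj x)]%classic.
Proof.
split=> /=.
- by move=> x /idl_sub/conj_ringint; rewrite conjK.
- by rewrite rmorph0; exact: idl0.
- by move=> x y Ix Iy; rewrite rmorphD; exact: idlD.
- by move=> a x Oa Ix; rewrite rmorphM; apply: idlM => //; apply: conj_ringint.
Qed.

Definition conj_idl I : idl K := Idl (is_ideal_conj I).

Lemma mem_conj_idl I x : I x -> conj_idl I (conj x).
Proof. by rewrite /= conjK. Qed.

Lemma nz_conj_idl I : nz_idl I -> nz_idl (conj_idl I).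
Proof.
by move=> [x Ix x0]; exists (conj x); [exact: mem_conj_idl|rewrite fmorph_eq0].
Qed.

Lemma qnm_gt0 x : x != 0 -> 0 < qnm x.
Proof.
move=> x0; have n_ge0 : 0 <= qnm x.
  by apply: addr_ge0; rewrite ?sqr_ge0 // mulr_ge0 ?sqr_ge0 ?ler0n.
rewrite lt_def n_ge0 andbT.
by rewrite -(fmorph_eq0 ia) /= -qnmE mulf_neq0 ?fmorph_eq0.
Qed.

(** Let g be the least positive integer in I * conj I; every integer of this ideal
    is a multiple of g.  For a and b in I the elements a * conj a, b * conj b and
    a * conj b + b * conj a of the ideal are integers, hence a * conj b / g has
    integral norm and trace.  So g divides all products generating the ideal. *)
Lemma idl_mul_conj I : nz_idl I ->
  exists2 g, (0 < g)%N & I * conj_idl I = pidl g%:R.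
Proof.
move=> nzI; pose S g := `[< (0 < g)%N /\ (I * conj_idl I)%R (g%:R : K) >].
have S_norm x : I x -> x != 0 -> exists2 n : nat, S n & qnm x = n%:R.
  move=> Ix x0; have [_] := (ringint_quadP x).1 (idl_sub Ix).
  move=> /intrP[m Em]; have := qnm_gt0 x0; rewrite Em ltr0z.
  case: m Em => // n Em n_gt0; exists n => //; apply/asboolP; split => //.
  have -> : n%:R = x * conj x by rewrite qnmE Em; symmetry; exact: (rmorph_nat ia).
  apply: mem_ideal_mul => //; exact: mem_conj_idl.
have exS : exists g, S g by have [x Ix /(S_norm x Ix)[n Sn _]] := nzI; exists n.
case: (ex_minnP exS) => g /asboolP[g_gt0 Ig] g_min.
have dvd_g m : (I * conj_idl I)%R (m%:~R : K) ->
    exists q : int, m%:~R = g%:R * q%:~R :> rat.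
  move=> Im; exists (m %/ g)%Z; rewrite -[g%:R]/(g%:~R) -intrM mulrC; congr _%:~R.
  rewrite {1}(divz_eq m g); have : (m %% g < g)%Z by apply: ltz_pmod.
  have : (0 <= m %% g)%Z by apply: modz_ge0; rewrite eqz_nat -lt0n.
  case Er: (m %% g)%Z => [[|r]|//] _; first by rewrite addr0.
  rewrite ltz_nat ltnNge g_min //; apply/asboolP; split => //.
  have -> : r.+1%:R = m%:~R - (m %/ g)%Z%:~R * g%:R :> K.
    by rewrite -[g%:R]/(g%:~R) -intrM -intrB {1}(divz_eq m g) Er addrAC subrr add0r.
  by apply: idlB => //; apply: idlM => //; apply: ringint_int.
have gK0 : g%:R != 0 :> K by rewrite -(prednK g_gt0) fext_nat_neq0.
have g0 : g%:R != 0 :> rat by rewrite pnatr_eq0 -lt0n.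
exists g => //; apply: idl_eq => z; split; last exact: pidl_sub.
apply: ideal_mul_sub => a b Ia Ib.
rewrite pidlE //; exists (a * b / g%:R); last by rewrite [RHS]mulrC divfK.
have Eg : g%:R^-1 = ia g%:R^-1 by rewrite fmorphV rmorph_nat.
have Ecg : conj (g%:R^-1) = ia g%:R^-1 by rewrite Eg conj_rat.
apply/ringint_quadP.
have Et : qtr (a * b / g%:R) = qtr (a * b) / g%:R.
  apply: (fmorph_inj ia); rewrite [in RHS]rmorphM /= -!qtrE !rmorphM /= Ecg Eg.
  by ring.
have En : qnm (a * b / g%:R) = (qnm a / g%:R) * (qnm b / g%:R).
  apply: (fmorph_inj ia); rewrite !(rmorphM ia) /= -!qnmE !rmorphM /= Ecg Eg.
  by ring.
have int_div (x : rat) : (forall m : int, x = m%:~R -> (I * conj_idl I)%R (m%:~R : K)) ->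
    x \is a Num.int -> x / g%:R \is a Num.int.
  move=> H /intrP[m Em]; have [q Eq] := dvd_g _ (H _ Em).
  by rewrite Em Eq mulrAC divff // mul1r intr_int.
have Oa := idl_sub Ia; have Ob := idl_sub Ib.
rewrite Et En; split; last apply: rpredM.
- apply: int_div => [m Em|]; last by case: ((ringint_quadP (a * b)).1 (ringintM Oa Ob)).
  rewrite -(rmorph_int ia) /= -Em -qtrE rmorphM; apply: (@idlD _ (I * conj_idl I)).
    by apply: mem_ideal_mul.
  by rewrite mulrC; apply: mem_ideal_mul => //; apply: mem_conj_idl.
- apply: int_div => [m Em|]; last by case: ((ringint_quadP a).1 Oa).
  rewrite -(rmorph_int ia) /= -Em -qnmE; apply: mem_ideal_mul => //.
  exact: mem_conj_idl.
- apply: int_div => [m Em|]; last by case: ((ringint_quadP b).1 Ob).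
  rewrite -(rmorph_int ia) /= -Em -qnmE mulrC; exact: mem_ideal_mul.
Qed.

Lemma pidl_nat_le g h : (0 < g)%N -> (forall x, pidl (g%:R : K) x -> pidl (h%:R : K) x) ->
  (h <= g)%N.
Proof.
move=> g_gt0 /(_ _ (mem_pidl (ringint_nat K g))); rewrite pidlE // => -[y Oy].
move: h => [//|h] E; have /rat_integral_int : O (ia (g%:R / h.+1%:R)).
  by rewrite fmorph_div !rmorph_nat E mulrC mulKf // fext_nat_neq0.
move=> /intrP[m Em]; have : g%:R = m%:~R * h.+1%:R :> rat.
  by rewrite -Em divfK // pnatr_eq0.
rewrite -[g%:R]/(g%:~R) -[h.+1%:R]/(h.+1%:~R) -intrM => /intr_inj/(congr1 absz).
rewrite abszM /= => Eg; rewrite Eg leq_pmull // lt0n; apply: contraTneq g_gt0 => m0.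
by rewrite Eg m0.
Qed.

Lemma idl_mulI I J L : nz_idl I -> I * J = I * L -> J = L.
Proof.
move=> /idl_mul_conj[g g_gt0 E] IJL; apply: (@pidl_inj _ g%:R) => //.
  by rewrite -(prednK g_gt0) fext_nat_neq0.
by rewrite -E -!mulrA ![conj_idl I * _]mulrC !mulrA IJL.
Qed.

(** If I is contained in J then the generator h of J * conj J is at most the
    generator g of I * conj I.  If they are equal, I * conj J lies between
    I * conj I and J * conj J, hence equals the latter, and I = J. *)
Lemma idl_ACC_ind (P : idl K -> Prop) :
  (forall I, nz_idl I ->
     (forall J, (forall x, I x -> J x) -> J <> I -> P J) -> P I) ->
  forall I, nz_idl I -> P I.
Proof.
move=> IH I nzI; have [g g_gt0 Eg] := idl_mul_conj nzI.
elim/ltn_ind: g => g IHg in I nzI g_gt0 Eg *.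
apply: IH => // J sIJ neIJ; have nzJ := nz_idlS sIJ nzI.
have [h h_gt0 Eh] := idl_mul_conj nzJ.
apply: (IHg h) => //.
rewrite ltn_neqAle; apply/andP; split; last first.
  apply: pidl_nat_le => // x; rewrite -Eg -Eh.
  by apply: ideal_mul_sub => a b Ia Ib; apply: mem_ideal_mul; apply: sIJ.
apply/eqP=> Egh; apply: neIJ; apply: (@idl_mulI (conj_idl J)).
  exact: nz_conj_idl.
apply: idl_eq => x; split; last first.
  by apply: ideal_mul_sub => a b Ja Ib; apply: mem_ideal_mul => //; apply: sIJ.
rewrite mulrC Eh Egh -Eg mulrC; apply: ideal_mul_sub => a b Ia Ib.
by apply: mem_ideal_mul => //; apply: sIJ.
Qed.

(** The quotient is g^-1 J * conj I, where g generates I * conj I. *)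
Lemma idl_dvd I J : nz_idl I -> (forall x, J x -> I x) -> exists J', J = I * J'.
Proof.
move=> nzI sJI; have [g g_gt0 E] := idl_mul_conj nzI.
have g0 : g%:R != 0 :> K by rewrite -(prednK g_gt0) fext_nat_neq0.
have iJ : is_ideal [set x | (J * conj_idl I)%R (g%:R * x)]%classic.
  split; rewrite /mkset.
  - move=> x; have sJ : forall y, (J * conj_idl I)%R y -> pidl (g%:R : K) y.
      rewrite -E => y; apply: ideal_mul_sub => a b Ja Ib; apply: mem_ideal_mul => //.
      exact: sJI.
    by move/sJ; rewrite pidlE // => -[y Oy /(mulfI g0)->].
  - by rewrite mulr0; apply: (@idl0 _ (J * conj_idl I)).
  - by move=> x y Jx Jy; rewrite mulrDr; apply: (@idlD _ (J * conj_idl I)).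
  - by move=> a x Oa Jx; rewrite mulrCA; apply: (@idlM _ (J * conj_idl I)).
exists (Idl iJ).
have EJ : pidl g%:R * Idl iJ = J * conj_idl I.
  apply: idl_eq => x; split; first by move=> /(mem_pidlM (ringint_nat _ _))[y Jy ->].
  move=> Jx; have : (pidl g%:R : idl K) x.
    move: Jx; rewrite -E; apply: ideal_mul_sub => a b Ja Ib; apply: mem_ideal_mul => //.
    exact: sJI.
  rewrite pidlE // => -[y Oy Ex]; rewrite Ex; apply: mem_ideal_mul; first exact: mem_pidl.
  by rewrite Ex in Jx.
apply: (@pidl_inj _ g%:R) => //.
by rewrite mulrCA EJ mulrCA -E mulrC mulrA.
Qed.

Lemma ringint_w : O w.
Proof.
apply: (@ringint_monic_root _ [:: d%:R; 0]).
  by move=> c; rewrite !inE => /orP[]/eqP->.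
by rewrite horner_Poly /= -(opprK d%:R) -sqr_w; ring.
Qed.

Lemma quadratic_dedekind : dedekind K.
Proof.
split; [exact: idl_mulI|exact: idl_ACC_ind|exact: idl_dvd|move=> x].
have O_den (a : rat) : O ((denq a)%:~R * ia a).
  rewrite -(rmorph_int ia) -rmorphM mulrC -numqE; apply: ringint_int_rat.
  exact: intr_int.
have den0 (a : rat) : (denq a)%:~R != 0 :> K.
  by rewrite -(rmorph_int ia) fmorph_eq0 intr_eq0 denq_eq0.
exists ((denq (qre x))%:~R * (denq (qim x))%:~R).
split; first by apply: ringintM; apply: ringint_int.
  by rewrite mulf_neq0.
rewrite {3}(quadE x) mulrDr; apply: ringintD.
  by rewrite mulrAC mulrC; apply: ringintM => //; apply: ringint_int.
rewrite mulrA -[_ * _ * ia _]mulrA; apply: ringintM; last exact: ringint_w.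
by apply: ringintM => //; exact: ringint_int.
Qed.

Lemma qtr_coord a b : qtr (ia a + ia b * w) = 2 * a.
Proof. by rewrite /qtr; have /quad_inj[<- _] := quadE (ia a + ia b * w); ring. Qed.

Lemma qnm_coord a b : qnm (ia a + ia b * w) = a ^+ 2 + d%:R * b ^+ 2.
Proof. by rewrite /qnm; have /quad_inj[<- <-] := quadE (ia a + ia b * w). Qed.

(** The coefficient of w in x^2 is twice the product of the two coordinates. *)
Lemma sqr_in_rat x c : x ^+ 2 = ia c ->
  qim x = 0 \/ qim x != 0 /\ d%:R * qim x ^+ 2 = - c.
Proof.
move=> Ex; have [->|im0] := eqVneq (qim x) 0; [by left|right; split => //].
have dE : d%:R = - w ^+ 2 by rewrite sqr_w opprK.
have : ia (qre x ^+ 2 - d%:R * qim x ^+ 2) + ia (2 * qre x * qim x) * w = ia c + ia 0 * w.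
  rewrite rmorph0 mul0r addr0 -Ex [in RHS](quadE x) rmorphB rmorphXn.
  by rewrite (rmorphM _ d%:R) rmorphXn !rmorphM !rmorph_nat dE /=; ring.
move=> /quad_inj[<- /eqP]; rewrite !mulf_eq0 (negPf im0) orbF /= => /eqP->.
by rewrite expr0n sub0r opprK.
Qed.

Hypothesis sqf_d : squarefree d.

(** The norm of e is 1, so 4 = tr(e)^2 + d j^2 where j, twice the coefficient of
    w, is an integer because d is squarefree; d > 4 forces j = 0. *)
Lemma ringint_unit e : (3 < d)%N -> e != 0 -> O e -> O e^-1 -> e = 1 \/ e = -1.
Proof.
move=> d3 e0 Oe Oe'; have [/intrP[t Et] /intrP[n En]] := (ringint_quadP e).1 Oe.
have [_ /intrP[n' En']] := (ringint_quadP _).1 Oe'.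
have Enn' : n * n' = 1.
  apply: (@intr_inj rat); rewrite intrM -En -En'.
  apply: (fmorph_inj ia); rewrite rmorphM rmorph1 /= -!qnmE fmorphV /=.
  by field; rewrite e0 fmorph_eq0 e0.
have n1 : n = 1.
  have : 0 < n by rewrite -(ltr0z rat) -En qnm_gt0.
  move/(congr1 absz): Enn' => /eqP; rewrite abszM muln_eq1 => /andP[/eqP n1 _] n_gt0.
  by rewrite -(gtz0_abs n_gt0) n1.
have d_neq4 : d <> 4%N by move=> d4; have := @sqf_d 2; rewrite d4 => /(_ isT).
have Ed : d%:R * (2 * qim e) ^+ 2 = (4 - t ^+ 2)%:~R.
  rewrite rmorphB rmorphXn /= -Et.
  have -> : 4%:~R = 4 * qnm e by rewrite En n1.
  by rewrite /qnm /qtr; ring.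
have /intrP[j Ej] : 2 * qim e \is a Num.int.
  by apply: (squarefree_rat_int sqf_d d_gt0); rewrite Ed intr_int.
have j0 : j = 0.
  have : (d%:Z * j ^+ 2 = 4 - t ^+ 2).
    by apply: (@intr_inj rat); rewrite -Ed Ej intrM rmorphXn.
  rewrite !expr2; nia.
have im0 : qim e = 0.
  by move: Ej => /eqP; rewrite j0 mulf_eq0 /= => /eqP.
have re1 : (qre e - 1) * (qre e + 1) = 0.
  by move: En; rewrite n1 /qnm im0 expr0n mulr0 addr0 => E; rewrite -subr_sqr_1 E subrr.
move/eqP: re1; rewrite mulf_eq0 subr_eq0 addr_eq0 => /orP[]/eqP E; [left|right];
  by rewrite (quadE e) im0 E rmorph0 mul0r addr0 ?rmorphN rmorph1.
Qed.

Lemma ringint_coordP a b : O (ia a + ia b * w) ->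
  2 * a \is a Num.int /\ a ^+ 2 + d%:R * b ^+ 2 \is a Num.int.
Proof. by move/ringint_quadP; rewrite qtr_coord qnm_coord. Qed.

Lemma quarter_int n : n%:R / 4 \is a @Num.int rat -> (4 %| n)%N.
Proof.
move=> /intrP[m Em]; have : n%:R = m%:~R * 4 :> rat by rewrite -Em divfK.
rewrite -[n%:R]/(n%:~R) -[4]/(4%:~R) -intrM => /intr_inj/(congr1 absz).
by rewrite abszM /= => ->; rewrite dvdn_mull.
Qed.

(** In the other residue classes (2) is not prime: it contains w^2 but not w if d is
    even, (1 + w)^2 but not 1 + w if d = 1 modulo 4, and the norm of (1 + w) / 2
    but neither this element nor its conjugate if d = 7 modulo 8. *)
Lemma inert_mod8 : inert K 2 -> (d %% 8 = 3)%N.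
Proof.
rewrite /inert; set two := principal_ideal _ => -[_ _ prime2].
have O2 : O 2 by apply: ringint_nat.
have n2 : (2 : K) != 0 by apply: fext_nat_neq0.
have halfP a b : two (ia a + ia b * w) -> O (ia (a / 2) + ia (b / 2) * w).
  move=> [y Oy E]; suff -> : ia (a / 2) + ia (b / 2) * w = y by [].
  apply: (mulfI n2); rewrite -E !fmorph_div /= rmorph_nat; by field.
have not4 : ~~ (4 %| d)%N.
  by apply/negP => d4; have := @sqf_d 2 d4.
have d_odd : (d %% 2 = 1)%N.
  case Ed: (d %% 2)%N (ltn_pmod d (isT : 0 < 2)%N) => [|[|//]] // _.
  case/negP: not4; apply: quarter_int.
  have tw : two w.
    suff H : two (w * w) by case: (prime2 w w ringint_w ringint_w H).
    rewrite -expr2 sqr_w; exists (- (d %/ 2)%:R); first by apply: ringintN.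
    by rewrite mulrN -natrM {1}(divn_eq d 2) Ed addn0 mulnC.
  have /halfP/ringint_coordP[_] : two (ia 0 + ia 1 * w).
    by rewrite rmorph0 rmorph1 add0r mul1r.
  by rewrite (_ : _ + _ = d%:R / 4) //; field.
have d_mod4 : (d %% 4 = 3)%N.
  have [//|d1] : (d %% 4 = 3 \/ d %% 4 = 1)%N by lia.
  have Ow1 : O (1 + w) by apply: ringintD => //; apply: ringint_w.
  have tw : two (1 + w).
    suff H : two ((1 + w) * (1 + w)) by case: (prime2 _ _ Ow1 Ow1 H).
    exists (w - (d %/ 2)%:R); first by apply: ringintB => //; apply: ringint_w.
    have : d%:R = 2 * (d %/ 2)%:R + 1 :> K.
      by rewrite {1}(divn_eq d 2) d_odd natrD natrM mulrC.
    have -> : (1 + w) * (1 + w) = 1 + 2 * w + w ^+ 2 by ring.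
    rewrite sqr_w => ->; ring.
  have /halfP/ringint_coordP[_] : two (ia 1 + ia 1 * w) by rewrite rmorph1 mul1r.
  rewrite (_ : _ + _ = d.+1%:R / 4); last by rewrite -natr1; field.
  by move/quarter_int; lia.
have [//|d7] : (d %% 8 = 3 \/ d %% 8 = 7)%N by lia.
pose om := ia (1 / 2) + ia (1 / 2) * w; pose om' := ia (1 / 2) + ia (- 1 / 2) * w.
have Ed : d%:R = 8 * (d %/ 8)%:R + 7 :> rat by rewrite -natrM -natrD; congr _%:R; lia.
have Oom (b : rat) : b ^+ 2 = 1 / 4 -> O (ia (1 / 2) + ia b * w).
  move=> Eb; apply/ringint_quadP; rewrite qtr_coord qnm_coord Eb Ed; split.
    by rewrite (_ : _ * _ = 1%:~R) ?intr_int //; field.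
  by rewrite (_ : _ + _ = (2 * (d %/ 8) + 2)%N%:R) ?natr_int // natrD natrM; field.
have Om : O om by apply: Oom; field.
have Om' : O om' by apply: Oom; field.
have : two (om * om').
  exists (d %/ 8 + 1)%N%:R => //.
  have -> : om * om' = ia (1 / 4 + 1 / 4 * d%:R).
    rewrite rmorphD (rmorphM _ (1 / 4)) (rmorph_nat ia d) -[d%:R]opprK -sqr_w /om /om'.
    rewrite !fmorph_div rmorphN rmorph1 !rmorph_nat.
    by field; rewrite ?fext_nat_neq0.
  rewrite Ed (_ : _ + _ = 2 * (d %/ 8 + 1)%N%:R); first by rewrite rmorphM !rmorph_nat.
  by rewrite natrD; field.
by case/(prime2 _ _ Om Om')=> /halfP/ringint_coordP[] + _;
  rewrite (_ : _ * _ = 1 / 2) //; field.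
Qed.

End QuadraticField.

(** * Curves with conductor supported at (2) *)

(** The fixed points of G_i are among the l^2 points of l-torsion, so their
    dimension is at most 2. *)
Lemma wild_exponent_ge0 (K : fieldType) (E : weierstrass K) p delta :
  wild_exponent E p delta -> 0 <= delta.
Proof.
move=> [l [L [T [P [n [[pr_l _] [_ sizeT _] _ _ [_ ->]]]]]]].
apply: sumr_ge0 => i _; apply: mulr_ge0; first by rewrite divr_ge0 ?ler0n.
rewrite subr_ge0 (ler_nat _ _ 2) /fixed_dim; set c := count _ _.
have le_c : (c <= l ^ 2)%N by rewrite -sizeT count_size.
have [->|c_gt0] := posnP c; first by rewrite logn0.
rewrite -(leq_exp2l _ _ (prime_gt1 pr_l)); apply: leq_trans le_c.
by apply: dvdn_leq => //; apply: pfactor_dvdnn.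
Qed.

Lemma good_reduction (K : fieldType) (E : weierstrass K) (N : set K) (P : idl K) :
  is_conductor E N -> prime_ideal P -> ~ ideal_dvd P N ->
  exists M, [/\ isomorphic E M, integral_model P M & unit_at P (wdisc M)].
Proof.
move=> [_ condN] pP nPN; have [f [[M [delta [minM wildM Ef]]] dvdN _]] := condN _ pP.
have f0 : f = 0%N.
  case: f {Ef} dvdN => // f [J iJ EN]; case: nPN.
  exists (P ^+ f * Idl iJ)%R; first exact: idlP.
  rewrite EN -[J]/(idl_set (Idl iJ)) -idl_setX.
  by rewrite -[LHS]/(idl_set (P ^+ f.+1 * Idl iJ)) exprS -mulrA.
have delta0 := wild_exponent_ge0 wildM.
have tame0 : tame_exponent P M = 0%N.
  apply/eqP; rewrite -leqn0 -(ler_nat rat).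
  by move: Ef; rewrite f0 => ->; rewrite lerDl.
have [isoM intM _] := minM; exists M; split=> //.
by move: tame0; rewrite /tame_exponent; case: asboolP => //; case: ifP.
Qed.

Lemma prime_inert (K : fieldType) q : inert K q -> prime_ideal (pidl (q%:R : K)).
Proof. by rewrite /inert pidlE. Qed.

Theorem theorem2p13 (d : nat) (hd3 : (3 < d)%N) (hdsf : squarefree d)
    (K : fieldExtType rat) (w : K) (hw : w ^+ 2 = - d%:R)
    (hK : <<1; w>>%VS = fullv)
    (h2 : inert K 2)
    (h : nat) (hh : is_class_number K h) (hh6 : coprime h 6)
    (E : weierstrass K) (hE : elliptic_curve E)
    (hE2 : exists P : rat_point K, has_order E P 2)
    (N : set K) (hN : is_conductor E N)
    (hN2 : forall p : set K, prime_ideal p -> ideal_dvd p N ->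
             p = principal_ideal 2) :
  exists E0 : weierstrass rat,
    elliptic_curve E0 /\ isomorphic E (base_change (in_alg K) E0).
Proof.
have d_gt0 : (0 < d)%N by apply: leq_trans hd3.
have ded := quadratic_dedekind d_gt0 hw hK.
have d8 := inert_mod8 d_gt0 hw hK hdsf h2.
have odd_h : odd h.
  by rewrite -coprimen2; move: hh6; rewrite (_ : 6 = 2 * 3)%N // coprimeMr => /andP[].
have p2 := prime_inert h2.
have O2 : ring_of_integers (2 : K) by apply: ringint_nat.
have n2 : (2 : K) != 0 by apply: fext_nat_neq0.
have n4 : (4 : K) != 0 by apply: fext_nat_neq0.
have notin2 (P : idl K) : prime_ideal P -> P <> pidl 2 -> ~ P 2.
  by move=> pP nP2 P2; apply/nP2/esym/(prime_maximal ded p2 pP)/sub_pidl.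
have [a [b isoW]] := isomorphic_torsion2_form n2 hE2.
have [b0 D0] : b != 0 /\ a ^+ 2 - 4 * b != 0.
  have [u [r [s [t [u0 /wdisc_iso]]]]] := isoW; rewrite wdisc_torsion2_form => Edisc.
  apply/andP; move: hE; rewrite /elliptic_curve -Edisc; apply: contraNT.
  by rewrite negb_and !negbK => /orP[]/eqP->; rewrite ?expr0n /= !(mulr0, mul0r).
have good (P : idl K) : prime_ideal P -> P <> pidl 2 -> exists2 u, u != 0 &
    unit_at P (b / u ^+ 4) /\ unit_at P ((a ^+ 2 - 4 * b) / u ^+ 4).
  move=> pP nP2; have [|M [isoM intM unitM]] := good_reduction hN pP.
    move=> /(hN2 _ pP) EP; apply: nP2; apply: idl_eq => x.
    by rewrite pidlE // EP.
  apply: (torsion2_form_good n2 pP (notin2 P pP nP2) _ intM unitM).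
  exact: isomorphic_trans (isomorphic_sym isoW) isoM.
have [|k [g [e [g0 Oe Oe' Eb]]]] := fourth_power_away ded O2 n2 p2 hh odd_h b0.
  by move=> P pP /(good P pP)[u u0 [Hb _]]; exists u.
have e0 : e != 0 by apply: contraNneq b0 => e0; rewrite Eb e0 mulr0 mul0r.
(* The curve y^2 = x^3 + a1 x^2 + b1 x is the given one rescaled by g. *)
pose a1 := a / g ^+ 2; pose b1 := 2 ^+ k * e.
have Eb1 : b = b1 * g ^+ 4 by rewrite Eb.
have b10 : b1 != 0 by rewrite mulf_neq0 // expf_neq0.
pose D1 := a1 ^+ 2 - 4 * b1.
have ED1 : (a ^+ 2 - 4 * b) = D1 * g ^+ 4 by rewrite /D1 /a1 Eb1; field.
have D10 : D1 != 0 by apply: contraNneq D0 => D10; rewrite ED1 D10 mul0r.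
have [|i [j [e' [Oe1 Oe1' ED]]]] := unit_away_frac ded O2 n2 p2 D10.
  move=> P pP nP2; have [u u0 [Hb HD]] := good P pP nP2.
  (* The scaling u depends on P; it cancels in the quotient by b. *)
  have -> : D1 = (a ^+ 2 - 4 * b) / u ^+ 4 * (b / u ^+ 4)^-1 * b1.
    by rewrite ED1 Eb1; field; rewrite u0 g0 b10.
  apply: (unit_atM pP); first by apply: (unit_atM pP) => //; apply: unit_atV.
  apply: (unit_atM pP); last exact: (unit_at_unit pP).
  by apply: (unit_atX pP); apply: (unit_at_O pP) => //; apply: notin2.
have e'0 : e' != 0.
  apply: contraNneq D10 => e'0; move/eqP: ED; rewrite e'0 mulr0 mulf_eq0.
  by rewrite expf_eq0 (negPf n2) andbF.
have isoE a2 : a1 = in_alg K a2 -> forall b2, b1 = in_alg K b2 ->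
    exists E0, elliptic_curve E0 /\ isomorphic E (base_change (in_alg K) E0).
  move=> Ea b2 Eb2; exists (torsion2_form a2 b2); split.
    rewrite /elliptic_curve wdisc_torsion2_form -(fmorph_eq0 (in_alg K)).
    rewrite !rmorphM rmorphB !rmorphXn rmorphM !rmorph_nat /= -Ea -Eb2.
    rewrite !mulf_neq0 ?expf_neq0 //; exact: fext_nat_neq0.
  apply: isomorphic_trans isoW _; exists g, 0, 0, 0; split=> //.
  split; rewrite /= ?rmorph0 ?(mulr0, mul0r, addr0, subr0, oppr0, expr0n) //=.
  - by rewrite -Ea /a1; field.
  - by rewrite -Eb2 mulrC -Eb1; ring.
have [eq Eeq eq1] : exists2 s : rat, e = in_alg K s & s = 1 \/ s = -1.
  case: (ringint_unit d_gt0 hw hK hdsf hd3 e0 Oe Oe') => ->.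
    by exists 1; [rewrite rmorph1|left].
  by exists (-1); [rewrite rmorphN rmorph1|right].
have [e'q Ee'q e'q1] : exists2 s : rat, e' = in_alg K s & s = 1 \/ s = -1.
  case: (ringint_unit d_gt0 hw hK hdsf hd3 e'0 Oe1 Oe1') => ->.
    by exists 1; [rewrite rmorph1|left].
  by exists (-1); [rewrite rmorphN rmorph1|right].
have Eb1q : b1 = in_alg K (2 ^+ k * eq) by rewrite rmorphM rmorphXn rmorph_nat /= -Eeq.
have : a1 ^+ 2 = in_alg K ((2 ^+ j * e'q + 2 ^+ (i + k).+2 * eq) / 2 ^+ i).
  rewrite fmorph_div rmorphD (rmorphM _ (2 ^+ j)) (rmorphM _ (2 ^+ (i + k).+2)).
  rewrite !rmorphXn rmorph_nat /= -Ee'q -Eeq -ED /D1 /b1.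
  by rewrite (exprS _ (i + k).+1) (exprS _ (i + k)) exprD; field; rewrite expf_neq0.
move=> /(sqr_in_rat d_gt0 hw hK)[im0|[im0 Ea1]].
  apply: (isoE (qre hw hK a1) _ _ Eb1q).
  by rewrite {1}(quadE hw hK a1) im0 rmorph0 mul0r addr0.
have [nq nq'] : (- e'q = 1 \/ - e'q = -1) /\ (- eq = 1 \/ - eq = -1).
  by split; [case: e'q1|case: eq1] => ->; rewrite ?opprK; [right|left|right|left].
case: (@rat_sqr_ne_two_powers d _ (- e'q) (- eq) i j (i + k).+2 hdsf hd3 d8 im0 nq nq').
by rewrite Ea1; field; rewrite expf_neq0.
Qed.
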